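(* Let $\omega=\omega(n)=o(\log n)$ be a function tending to infinity with $n$. Let $p=p(n)$ satisfy \[ \left(\frac{2\log n + \omega}{n}\right)^{1/2} \le p \le 1 - \frac{3\log \log n}{\log n}, \qquad \eta=\frac{\log(1/p)}{\log n}, \] let $q=1-p$, $\rho=p^2+q^2$, and let $c$ be a positive constant such that \[ 0< c < \min\left\{ \frac{1}{2}\left( \frac{\log n - 3\log\log n}{\log(1/p)} - 1\right), 1 \right\}. \] Then asymptotically almost surely \[ \left(1 - 2\eta-\frac{4\log\log n}{\log n}\right) \frac{2\log n}{\log (1/\rho)}\le \zeta(G_{n,p})\le (1 - c\eta) \frac{2\log n}{\log (1/\rho)}. \]
   Context: $G_{n,p}$ is the Erdős–Rényi random graph on vertex set $[n]$ where each pair is an edge independently with probability $p$. Localization game on a graph $G$: a robber occupies an (unknown to the cop) vertex $v$. In each round the cop chooses a set $W=\{w_1,\dots,w_k\}$ of $k$ vertices (a new set may be chosen each round) and is told the distances $\mathrm{dist}(v,w_i)$, $i=1,\dots,k$ (the $W$-signature of $v$). The cop wins if this information (together with information from previous rounds) determines $v$ exactly; otherwise the robber moves to a neighbor of its current vertex and a new round starts. The localization number $\zeta(G)$ is the minimum $k$ such that the cop, using test sets of size $k$, has a strategy guaranteeing to eventually determine the robber's location. ''Asymptotically almost surely'' (a.a.s.) means with probability tending to $1$ as $n\to\infty$. All logarithms are natural. *)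

(* Defs.v *)
(* MathComp / MathComp-Analysis. *)
From HB Require Import structures.
From mathcomp Require Import all_boot all_order all_algebra.
From mathcomp Require Import all_classical all_reals all_analysis.

Set Implicit Arguments.
Unset Strict Implicit.
Unset Printing Implicit Defensive.

Import Order.TTheory GRing.Theory Num.Theory.
Import numFieldNormedType.Exports.

Local Open Scope ring_scope.

Section Localization.
Variables (V : finType) (G : rel V).

Definition walk_of_length (d : nat) (u v : V) : bool :=
  [exists s : d.-tuple V, path G u s && (last u s == v)].

(* Finite distances are at most #|V| - 1; [find] returns #|V| when v is not
   reachable from u, so the value #|V| encodes an infinite distance. *)
Definition dist (u v : V) : nat :=
  find (fun d => walk_of_length d u v) (iota 0 #|V|).

(* The cop knows W, so the order in which W is enumerated is immaterial. *)
Definition signature (W : {set V}) (v : V) : seq nat :=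
  [seq dist v w | w <- enum W].

(* A robber on an isolated vertex has no neighbour to move to and stays. *)
Definition robber_step (u v : V) : bool :=
  G u v || ((u == v) && [forall w, ~~ G u w]).

Definition robber_walk (r : nat -> V) : Prop :=
  forall t, robber_step (r t) (r t.+1).

(* A cop strategy maps the signatures received so far to the next test set;
   the earlier test sets are recovered from these signatures.  [history s r t]
   lists the signatures received in rounds 0, ..., t - 1. *)
Fixpoint history (s : seq (seq nat) -> {set V}) (r : nat -> V) (t : nat)
    : seq (seq nat) :=
  if t is t'.+1 then
    let h := history s r t' in rcons h (signature (s h) (r t'))
  else [::].

(* The strategy is deterministic, hence quantifying over all robber walks fixed
   in advance is the same as playing against an adaptive robber. *)
Definition locates_at (s : seq (seq nat) -> {set V}) (r : nat -> V) (t : nat)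
    : Prop :=
  forall r', robber_walk r' -> history s r' t.+1 = history s r t.+1 ->
    r' t = r t.

Definition cop_wins (k : nat) : Prop :=
  exists s : seq (seq nat) -> {set V},
    (forall h, #|s h| = k) /\
    (forall r, robber_walk r -> exists t, locates_at s r t).

Lemma dist_eq0 (u v : V) : (dist u v == 0)%N = (u == v).
Proof.
rewrite /dist; have : (0 < #|V|)%N by apply/card_gt0P; exists u.
case: #|V| => [//|m] _ /=.
have -> : walk_of_length 0 u v = (u == v).
  apply/existsP/eqP => [[s]|->]; last by exists [tuple] => /=.
  by rewrite tuple0 /= => /eqP.
by case: (u == v).
Qed.

Lemma cop_wins_card : cop_wins #|V|.
Proof.
exists (fun=> [set: V]); split=> [h|r _]; first by rewrite cardsT.
exists 0%N => r' _ /= [] /eq_in_map /(_ (r 0%N)).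
rewrite mem_enum finset.in_setT => /(_ isT) e.
by apply/eqP; rewrite -dist_eq0 e dist_eq0.
Qed.

Lemma exists_cop_wins : exists k, `[< cop_wins k >].
Proof. by exists #|V|; apply/asboolP; exact: cop_wins_card. Qed.

Definition localization_number : nat := ex_minn exists_cop_wins.

End Localization.

Section ErdosRenyi.
Variables (R : realType) (n : nat).

Definition vertex_pairs : {set {set 'I_n}} := [set e : {set 'I_n} | #|e| == 2].

Definition adj (E : {set {set 'I_n}}) : rel 'I_n :=
  fun u v => [set u; v] \in E.

(* Probability that the edge set E of G_{n,p} satisfies A; no loops arise, as
   E only contains sets of cardinality two. *)
Definition gnp_prob (p : R) (A : pred {set {set 'I_n}}) : R :=
  \sum_(E in powerset vertex_pairs | A E)
    \prod_(e in vertex_pairs) (if e \in E then p else 1 - p).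

End ErdosRenyi.

Arguments gnp_prob {R} n p A.

(* Main.v *)
(** The cop's test set [W] is useful to the extent that it separates pairs of
    vertices.  For fixed [W], a given pair keeps the same adjacency pattern to
    [W] with probability [rho ^ #|W|], so roughly [n^2 rho^k] pairs survive.

    Upper bound.  With high probability every pair is separated by at least
    [2 p (1 - p) (1 - 1/L) n] vertices, so a greedy choice of [k] vertices leaves at
    most [|A|^2 e^4 rho^k] unseparated ordered pairs in a candidate set [A].
    After a signature class [S], the robber is in a set of at most [5 p n |S|]
    vertices.  If [p] is below a constant depending on [c], the greedy test set
    splits that set into classes smaller than [S], and the candidate sets shrink
    to one point.  If [p] is larger, all of [V] has [O(2^m)] unseparated pairs
    after [k - m] greedy vertices, so its classes have at most [2^m] elements and
    [m] further vertices, with adjacencies prescribed by the extension property,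
    separate everything in one round.

    Lower bound.  With high probability the diameter is at most two and no [W] of
    size [K] separates the neighbours of any vertex, so that the robber can always
    move to one of two indistinguishable vertices.  The probability that [j]
    independent samples of a law [w] are distinct is [j!] times the [j]-th
    elementary symmetric function of [w], at most
    [e (j + 1) exp (1/2 - j sqrt(sum w^2) / 4)]; this is small enough for a union
    bound over all the sets [W]. *)

Require Import Defs.
From mathcomp Require Import all_boot all_order all_algebra.
From mathcomp Require Import all_classical all_reals all_analysis.
From mathcomp Require Import zify ring lra.
(* Imported again because [all_classical] shadows [subsetP], [subUset], etc. *)
From mathcomp Require Import fintype finset.

Set Implicit Arguments.
Unset Strict Implicit.
Unset Printing Implicit Defensive.

Import Order.TTheory GRing.Theory Num.Theory.
Import numFieldNormedType.Exports.

Local Open Scope ring_scope.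

(** * Random sets with independent elements *)

Section RandomSubset.
Variables (R : realType) (T : finType) (D : {set T}) (p : R).

Definition subset_weight (E : {set T}) : R :=
  \prod_(e in D) (if e \in E then p else 1 - p).

Definition subset_mean (f : {set T} -> R) : R :=
  \sum_(E in powerset D) subset_weight E * f E.

Lemma sum_powerset_prod (F : T -> bool -> R) :
  \sum_(E in powerset D) \prod_(e in D) F e (e \in E) =
  \prod_(e in D) (F e true + F e false).
Proof.
pose F' e := if e \in D then F e true else 0.
pose G' e := if e \in D then F e false else 1.
transitivity (\prod_e (F' e + G' e)); last first.
  rewrite [RHS]big_mkcond; apply: eq_bigr => e _; rewrite /F' /G'.
  by case: ifP => //; rewrite add0r.
rewrite bigA_distr [RHS](bigID (mem (powerset D))) /= [X in _ = _ + X]big1 ?addr0.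
  apply: eq_bigr => E; rewrite powersetE => /subsetP ED.
  rewrite [LHS]big_mkcond; apply: eq_bigr => e _; rewrite /F' /G'.
  by case: (boolP (e \in E)) => [/ED ->//|_]; case: ifP.
move=> E; rewrite powersetE => /subsetPn[e eE eD].
by rewrite (bigD1 e)//= eE /F' (negbTE eD) mul0r.
Qed.

Lemma subset_mean_edges (I : finType) (e : I -> T) (phi : I -> bool -> R) :
  injective e -> (forall i, e i \in D) ->
  subset_mean (fun E => \prod_i phi i (e i \in E)) =
  \prod_i (p * phi i true + (1 - p) * phi i false).
Proof.
move=> inje eD; pose psi x b := \prod_(i | e i == x) phi i b.
have eDP : forall i : I, true -> e i \in D by [].
transitivity (\sum_(E in powerset D)
   \prod_(x in D) ((if x \in E then p else 1 - p) * psi x (x \in E))).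
  apply: eq_bigr => E _; rewrite big_split/=; congr (_ * _).
  rewrite (partition_big e (mem D))//=.
  by apply: eq_bigr => x xD; apply: eq_bigr => i /eqP ->.
rewrite (sum_powerset_prod (fun x b => (if b then p else 1 - p) * psi x b)).
rewrite [RHS](partition_big e (mem D))//=; apply: eq_bigr => x xD.
have [i /eqP ei|noi] := pickP (fun i => e i == x).
  rewrite /psi !(big_pred1 i)// => j /=; rewrite -ei;
  by apply/eqP/eqP => [/inje|->].
by rewrite /psi !big_pred0// !mulr1 addrC subrK.
Qed.

Lemma sum_subset_weight : \sum_(E in powerset D) subset_weight E = 1.
Proof.
rewrite (sum_powerset_prod (fun=> fun b => if b then p else 1 - p)).
by rewrite big1// => e _; rewrite addrC subrK.
Qed.

Lemma subset_meanZ a f :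
  subset_mean (fun E => a * f E) = a * subset_mean f.
Proof. by rewrite mulr_sumr; apply: eq_bigr => E _; rewrite mulrCA. Qed.

Lemma subset_mean_sum (I : finType) (P : pred I) (f : I -> {set T} -> R) :
  subset_mean (fun E => \sum_(i | P i) f i E) =
  \sum_(i | P i) subset_mean (f i).
Proof.
by rewrite exchange_big/=; apply: eq_bigr => E _; rewrite mulr_sumr.
Qed.

Lemma eq_subset_mean f g : f =1 g -> subset_mean f = subset_mean g.
Proof. by move=> fg; apply: eq_bigr => E _; rewrite fg. Qed.

Hypothesis p01 : 0 <= p <= 1.

Lemma subset_weight_ge0 E : 0 <= subset_weight E.
Proof.
by apply: prodr_ge0 => e _; case: ifP; case/andP: p01 => *; rewrite ?subr_ge0.
Qed.

Lemma le_subset_mean f g : (forall E, f E <= g E) ->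
  subset_mean f <= subset_mean g.
Proof.
by move=> fg; apply: ler_sum => E _; rewrite ler_wpM2l// subset_weight_ge0.
Qed.

(* Exchanging the parts outside [D1] of two independent copies [E], [E'] preserves
   their joint law, and turns [f E * g E'] into [f * g] at a single copy. *)
Lemma subset_mean_indep (D1 : {set T}) (f g : {set T} -> R) :
  (forall E, f (E :&: D1) = f E) -> (forall E, g (E :\: D1) = g E) ->
  subset_mean (fun E => f E * g E) = subset_mean f * subset_mean g.
Proof.
move=> fD gD; pose mix (A B : {set T}) := (A :&: D1) :|: (B :\: D1).
have mixK A B : mix (mix A B) (mix B A) = A.
  by apply/setP => x; rewrite !inE; case: (x \in D1); rewrite /= ?andbT ?andbF ?orbF.
have mixD A B : A \in powerset D -> B \in powerset D -> mix A B \in powerset D.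
  rewrite !powersetE => AD BD; rewrite subUset (subset_trans (subsetIl _ _) AD).
  by rewrite (subset_trans (subsetDl _ _) BD).
have fmix A B : f (mix A B) = f A.
  by rewrite -fD -[RHS]fD; congr f; apply/setP => x; rewrite !inE; case: (x \in D1); rewrite /= ?andbT ?andbF ?orbF.
have gmix A B : g (mix A B) = g B.
  by rewrite -gD -[RHS]gD; congr g; apply/setP => x; rewrite !inE; case: (x \in D1); rewrite /= ?andbT ?andbF ?orbF.
have wmix A B : subset_weight (mix A B) * subset_weight (mix B A) =
    subset_weight A * subset_weight B.
  rewrite -!big_split; apply: eq_bigr => x _ /=.
  rewrite !inE; case: (x \in D1); rewrite /= ?andbT ?andbF ?orbF//.
  by rewrite mulrC.
transitivity (\sum_(E in powerset D) \sum_(E' in powerset D)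
    subset_weight E * subset_weight E' * (f E * g E)).
  apply: eq_bigr => E _; under eq_bigr do rewrite mulrAC.
  by rewrite -mulr_sumr sum_subset_weight mulr1.
rewrite mulr_suml; under [RHS]eq_bigr do rewrite mulr_sumr.
rewrite !pair_big_dep/=.
rewrite (reindex_onto (fun u => (mix u.1 u.2, mix u.2 u.1))
  (fun u => (mix u.1 u.2, mix u.2 u.1)))/=; last first.
  by move=> [A B] _ /=; rewrite !mixK.
apply: eq_big => [[A B]|[A B] _] /=.
  rewrite !mixK eqxx andbT; apply/andP/andP => -[hA hB]; last by rewrite !mixD.
  by split; [rewrite -(mixK A B)|rewrite -(mixK B A)]; rewrite mixD.
by rewrite fmix gmix wmix mulrACA.
Qed.

End RandomSubset.

(** * Adjacency patterns in G(n,p) *)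

Section InjectiveSamples.
Variable R : realType.

Lemma sum_injective_prod (J I : finType) (w : I -> R) :
  \sum_(f : {ffun J -> I} | injectiveb f) \prod_j w (f j) =
  (#|J| `!)%:R * \sum_(A : {set I} | #|A| == #|J|) \prod_(i in A) w i.
Proof.
rewrite (partition_big (fun f : {ffun J -> I} => f @: setT)
  (fun A : {set I} => #|A| == #|J|))/=; last first.
  by move=> f /injectiveP injf; rewrite card_imset// cardsT.
rewrite mulr_sumr; apply: eq_bigr => A /eqP cardA.
rewrite (eq_bigr (fun=> \prod_(i in A) w i)); last first.
  move=> f /andP[/injectiveP injf /eqP <-].
  by rewrite big_imset/=; [apply: eq_bigl => j; rewrite inE|move=> ? ? _ _ /injf].
rewrite sumr_const mulr_natl; congr (_ *+ _).
rewrite -[RHS](ffactnn #|J|) -{1}cardA -(card_inj_ffuns_on _ (mem A)).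
apply: eq_card => f; rewrite !inE [LHS]unfold_in /= andbC.
have [/injectiveP injf|] := boolP (injectiveb f); last by rewrite !andbF.
rewrite !andbT; apply/eqP/ffun_onP => [<- j|fA].
  exact: imset_f.
apply/eqP; rewrite eqEcard cardA card_imset// cardsT leqnn andbT.
by apply/subsetP => _ /imsetP[j _ ->]; apply: fA.
Qed.

Lemma fact_le_expR (j : nat) :
  (j`!)%:R * expR j%:R <= expR 1 * j.+1%:R * j%:R ^+ j :> R.
Proof.
have e1 : 1 <= expR 1 :> R by rewrite -expR0 ler_expR.
case: j => [|j]; first by rewrite fact0 expR0 expr0 !mulr1.
suff : ((j.+1)`!)%:R * expR j.+1%:R <= expR 1 * j.+1%:R * j.+1%:R ^+ j.+1 :> R.
  move=> /le_trans; apply; rewrite ler_wpM2r ?exprn_ge0//.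
  by rewrite ler_wpM2l ?expR_ge0// ler_nat.
elim: j => [|j IH]; first by rewrite (_ : 1`! = 1%N)// expr1 !mulr1 mul1r.
rewrite factS natrM.
have -> : expR j.+2%:R = expR j.+1%:R * expR 1 :> R by rewrite -expRD natr1.
have jj : j.+1%:R ^+ j.+2 * expR 1 <= j.+2%:R ^+ j.+2 :> R.
  have h : j.+1%:R * expR (j.+2%:R^-1) <= j.+2%:R :> R.
    have := expR_ge1Dx (- (j.+2%:R^-1) : R).
    have -> : 1 - j.+2%:R^-1 = j.+1%:R / j.+2%:R :> R.
      by apply: (mulIf (_ : j.+2%:R != 0)); rewrite ?pnatr_eq0// mulrBl mul1r
        mulVf ?mulfVK ?pnatr_eq0// -[j.+2%:R]natr1 addrK.
    by rewrite expRN ler_pdivrMr// [_^-1 * _]mulrC ler_pdivlMr ?expR_gt0.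
  apply: le_trans (lerXn2r j.+2 _ _ h) => //; rewrite ?nnegrE ?mulr_ge0 ?expR_ge0//.
  by rewrite exprMn -expRM_natr mulVf ?pnatr_eq0.
apply: le_trans (_ : expR 1 * j.+2%:R * (j.+1%:R ^+ j.+2 * expR 1) <= _); last first.
  by rewrite ler_wpM2l// mulr_ge0// expR_ge0.
have -> : expR 1 * j.+2%:R * (j.+1%:R ^+ j.+2 * expR 1) =
  (j.+2%:R * expR 1) * (expR 1 * j.+1%:R * j.+1%:R ^+ j.+1) :> R.
  by rewrite [in LHS]exprS; ring.
rewrite [expR j.+1%:R * _]mulrC mulrACA ler_wpM2l// ?mulr_ge0 ?expR_ge0//.
Qed.

Lemma onedD_le_expR (t : R) : 0 <= t ->
  1 + t <= expR (t - t ^+ 2 / (2 * (2 + t))).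
Proof.
move=> t0; set h := Num.sqrt (1 + t).
have h0 : 0 <= h by exact: sqrtr_ge0.
have h2 : h ^+ 2 = 1 + t by rewrite sqr_sqrtr// addr_ge0.
have hexp : h <= expR (h - 1) by have := expR_ge1Dx (h - 1); rewrite addrC subrK.
rewrite -h2; apply: le_trans (lerXn2r 2 _ _ hexp) _; rewrite ?nnegrE ?expR_ge0//.
rewrite -expRM_natr ler_expR.
have -> : t = h ^+ 2 - 1 by rewrite h2; ring.
rewrite -subr_ge0.
have -> : h ^+ 2 - 1 - (h ^+ 2 - 1) ^+ 2 / (2 * (2 + (h ^+ 2 - 1))) - (h - 1) * 2
  = (h - 1) ^+ 4 / (2 * (1 + h ^+ 2)).
  by field; nra.
by rewrite divr_ge0// ?exprn_even_ge0//; nra.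
Qed.

Lemma sum_injective_le (J I : finType) (w : I -> R) :
  (forall i, 0 <= w i) -> \sum_i w i = 1 ->
  \sum_(f : {ffun J -> I} | injectiveb f) \prod_j w (f j) <=
  expR 1 * #|J|.+1%:R * expR (2^-1 - #|J|%:R * Num.sqrt (\sum_i w i ^+ 2) / 4).
Proof.
move=> w0 w1; set j := #|J|; set r := Num.sqrt _; set s := j%:R * r.
have r0 : 0 <= r by exact: sqrtr_ge0.
have s0 : 0 <= s by rewrite mulr_ge0.
have r2 : r ^+ 2 = \sum_i w i ^+ 2.
  by rewrite sqr_sqrtr// sumr_ge0// => i _; rewrite sqr_ge0.
have wr i : w i <= r.
  rewrite -(@ler_pXn2r _ 2)// ?nnegrE// r2 (bigD1 i)//= lerDl.
  by rewrite sumr_ge0// => k _; rewrite sqr_ge0.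
have yj0 : 0 < j%:R ^+ j :> R.
  by case: (posnP j) => [->|j0]; rewrite ?expr0 ?ltr01// exprn_gt0// ltr0n.
rewrite sum_injective_prod -/j; set e := \sum_(A | _) _.
have e0 : 0 <= e by rewrite sumr_ge0// => A _; apply: prodr_ge0.
have yeE : j%:R ^+ j * e <= expR (j%:R + 2^-1 - s / 4).
  apply: le_trans (_ : \prod_i (j%:R * w i + 1) <= _).
    rewrite bigA_distr mulr_sumr [leRHS](bigID (fun A : {set I} => #|A| == j))/=.
    have nn A : 0 <= \prod_i (if i \in A then j%:R * w i else 1).
      by apply: prodr_ge0 => i _; case: ifP => // _; rewrite mulr_ge0.
    rewrite -[leLHS]addr0 lerD ?sumr_ge0//; apply: ler_sum => A /eqP jA.
    rewrite -big_mkcond/= big_split/= prodr_const jA.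
    exact: lexx.
  apply: le_trans (_ : \prod_i expR (j%:R * w i - (j%:R * w i) ^+ 2 / (2 * (2 + s))) <= _).
    apply: ler_prod => i _; rewrite addr_ge0 ?mulr_ge0//= addrC.
    have t0 : 0 <= j%:R * w i by rewrite mulr_ge0.
    apply: le_trans (onedD_le_expR t0) _; rewrite ler_expR lerD2l lerN2.
    rewrite ler_wpM2l ?sqr_ge0// lef_pV2 ?posrE; try lra.
    by rewrite ler_pM2l// lerD2l ler_wpM2l.
  rewrite -expR_sum ler_expR sumrB -mulr_sumr w1 mulr1 -mulr_suml.
  under eq_bigr do rewrite exprMn.
  rewrite -mulr_sumr -r2 -exprMn -/s -[leRHS]addrA lerD2l -subr_ge0.
  have -> : 2^-1 - s / 4 - - (s ^+ 2 / (2 * (2 + s))) = (s ^+ 2 + 4) / (4 * (2 + s)).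
    by field; lra.
  by rewrite divr_ge0 ?addr_ge0 ?sqr_ge0 ?mulr_ge0 ?addr_ge0.
rewrite -(@ler_pM2r _ (expR j%:R * j%:R ^+ j)) ?mulr_gt0 ?expR_gt0//.
have -> : (j`!)%:R * e * (expR j%:R * j%:R ^+ j) =
  ((j`!)%:R * expR j%:R) * (j%:R ^+ j * e) by ring.
have -> : expR 1 * j.+1%:R * expR (2^-1 - s / 4) * (expR j%:R * j%:R ^+ j) =
  (expR 1 * j.+1%:R * j%:R ^+ j) * expR (j%:R + 2^-1 - s / 4).
  by rewrite -[j%:R + _ - _]addrA [expR (_ + (_ - _))]expRD; ring.
by apply: ler_pM => //; rewrite ?mulr_ge0 ?expR_ge0 ?(ltW yj0)// fact_le_expR.
Qed.

End InjectiveSamples.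

Section Pattern.
Variables (R : realType) (n : nat) (p : R).
Implicit Types (E : {set {set 'I_n}}) (A : pred {set {set 'I_n}}).

Lemma gnp_probE A :
  gnp_prob n p A = subset_mean (vertex_pairs n) p (fun E => (A E)%:R).
Proof.
rewrite /gnp_prob big_mkcondr; apply: eq_bigr => E _.
by case: (A E); rewrite (mulr1, mulr0).
Qed.

Definition pattern_weight (W : finType) (S : {set W}) : R :=
  \prod_a (if a \in S then p else 1 - p).

Lemma sum_pattern_weight (W : finType) : \sum_(S : {set W}) pattern_weight S = 1.
Proof.
transitivity (\prod_(a : W) (p + (1 - p))).
  by rewrite bigA_distr; apply: eq_bigl => S; rewrite inE.
by rewrite big1// => a _; rewrite addrC subrK.
Qed.

Lemma sum_pattern_weight_sqr (W : finType) :
  \sum_(S : {set W}) pattern_weight S ^+ 2 = (p ^+ 2 + (1 - p) ^+ 2) ^+ #|W|.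
Proof.
transitivity (\prod_(a : W) (p ^+ 2 + (1 - p) ^+ 2)); last by rewrite prodr_const.
rewrite bigA_distr; apply: eq_big => [S|S _]; first by rewrite inE.
by rewrite -prodrXl; apply: eq_bigr => a _; case: ifP.
Qed.

Variables (J W : finType) (x : J -> 'I_n) (u : W -> 'I_n).
Hypotheses (injx : injective x) (inju : injective u).
Hypothesis xu : forall j a, x j != u a.

Definition pattern E : {ffun J -> {set W}} :=
  [ffun j => [set a | adj E (x j) (u a)]].

Lemma subset_mean_pattern (Phi : {ffun J -> {set W}} -> R) :
  subset_mean (vertex_pairs n) p (fun E => Phi (pattern E)) =
  \sum_f Phi f * \prod_j pattern_weight (f j).
Proof.
pose e (i : J * W) := [set x i.1; u i.2].
have inje : injective e.
  move=> [j a] [j' a'] /setP ee.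
  have /esym := ee (x j); rewrite !inE eqxx (negbTE (xu _ _)) orbF => /eqP/injx jj.
  have := ee (u a); rewrite !inE eqxx orbT eq_sym (negbTE (xu _ _)) => /esym/eqP/inju aa.
  by rewrite jj aa.
have eV i : e i \in vertex_pairs n by rewrite inE cards2 xu.
pose ind (f : {ffun J -> {set W}}) E : R := \prod_(i : J * W) ((e i \in E) == (i.2 \in f i.1))%:R.
have PhiE E : Phi (pattern E) = \sum_(f : {ffun J -> {set W}}) Phi f * ind f E.
  rewrite (bigD1 (pattern E))//= [X in _ + X]big1 ?addr0 => [|f].
    by rewrite /ind big1 ?mulr1// => i _; rewrite ffunE inE eqxx.
  move=> fE; apply/eqP; rewrite mulf_eq0; apply/orP; right.
  have [[j a] /= ja|h] := pickP (fun i => (e i \in E) != (i.2 \in f i.1)).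
    by rewrite /ind (bigD1 (j, a))//= (negbTE ja) mul0r.
  case/eqP: fE; apply/ffunP => j; apply/setP => a; rewrite ffunE inE.
  by have /= /negbFE/eqP := h (j, a); rewrite /adj.
rewrite (eq_subset_mean _ _ PhiE) subset_mean_sum; apply: eq_bigr => f _.
rewrite subset_meanZ; congr (_ * _).
rewrite (subset_mean_edges _ (fun i b => (b == (i.2 \in f i.1))%:R))//.
rewrite -(pair_bigA _ (fun j a => p * (true == (a \in f j))%:R +
  (1 - p) * (false == (a \in f j))%:R))/=.
apply: eq_bigr => j _; apply: eq_bigr => a _.
by case: ifP; rewrite /= ?mulr1 ?mulr0 ?addr0 ?add0r.
Qed.

Lemma subset_mean_pattern_prod (g : {set W} -> R) :
  subset_mean (vertex_pairs n) p (fun E => \prod_j g (pattern E j)) =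
  (\sum_S pattern_weight S * g S) ^+ #|J|.
Proof.
rewrite (subset_mean_pattern (fun f => \prod_j g (f j))).
transitivity (\prod_(j : J) \sum_S pattern_weight S * g S); last first.
  by rewrite prodr_const.
rewrite bigA_distr_bigA; apply: eq_bigr => f _.
by rewrite big_split/= mulrC.
Qed.

Lemma gnp_injective_pattern : 0 <= p <= 1 ->
  gnp_prob n p (fun E => injectiveb (pattern E)) <=
  expR 1 * #|J|.+1%:R *
    expR (2^-1 - #|J|%:R * Num.sqrt ((p ^+ 2 + (1 - p) ^+ 2) ^+ #|W|) / 4).
Proof.
move=> /andP[p0 p1].
rewrite gnp_probE (subset_mean_pattern (fun f => (injectiveb f)%:R)).
rewrite -sum_pattern_weight_sqr; apply: le_trans (sum_injective_le _ _ _).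
- by rewrite [leRHS]big_mkcond/=; apply: ler_sum => f _; case: ifP; rewrite ?mul1r ?mul0r.
- by move=> S; apply: prodr_ge0 => a _; case: ifP; rewrite ?subr_ge0.
- exact: sum_pattern_weight.
Qed.

End Pattern.

Section GnpEstimates.
Variables (R : realType) (n : nat) (p : R).
Hypothesis p01 : 0 <= p <= 1.
Implicit Types (E : {set {set 'I_n}}) (A B : pred {set {set 'I_n}}).

Lemma gnp_prob_mono A B : (forall E, A E -> B E) ->
  gnp_prob n p A <= gnp_prob n p B.
Proof.
move=> AB; rewrite !gnp_probE; apply: le_subset_mean => // E.
by rewrite ler_nat; case: (A E) (AB E) => // ->.
Qed.

Lemma gnp_prob_markov A (f : {set {set 'I_n}} -> R) :
  (forall E, 0 <= f E) -> (forall E, A E -> 1 <= f E) ->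
  gnp_prob n p A <= subset_mean (vertex_pairs n) p f.
Proof.
move=> f0 f1; rewrite gnp_probE; apply: le_subset_mean => // E.
by case: (A E) (f1 E) => [->//|_]; exact: f0.
Qed.

Lemma gnp_prob_union (I : finType) (Q : pred I) (A_ : I -> pred {set {set 'I_n}}) A (b : R) :
  (forall E, A E -> exists2 i, Q i & A_ i E) ->
  (forall i, Q i -> gnp_prob n p (A_ i) <= b) ->
  gnp_prob n p A <= #|Q|%:R * b.
Proof.
move=> AQ Ab; rewrite mulr_natl -sumr_const; apply: le_trans (ler_sum _ Ab).
under [leRHS]eq_bigr do rewrite gnp_probE.
rewrite -subset_mean_sum; apply: gnp_prob_markov => [E|E /AQ[i Qi Ai]].
  by rewrite sumr_ge0.
by rewrite (bigD1 i)//= Ai lerDl sumr_ge0.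
Qed.

Lemma gnp_probC A : gnp_prob n p A = 1 - gnp_prob n p (predC A).
Proof.
apply/eqP; rewrite eq_sym subr_eq; apply/eqP; rewrite !gnp_probE -big_split/=.
rewrite -[LHS](sum_subset_weight (vertex_pairs n) p); apply: eq_bigr => E _.
by rewrite -mulrDr /=; case: (A E); rewrite /= (addr0, add0r) mulr1.
Qed.

Lemma gnp_prob_ge0 A : 0 <= gnp_prob n p A.
Proof.
by rewrite gnp_probE sumr_ge0// => E _; rewrite mulr_ge0// subset_weight_ge0.
Qed.

Lemma subset_mean_degree (v : 'I_n) (X : {set 'I_n}) (a : R) : v \notin X ->
  subset_mean (vertex_pairs n) p (fun E => a ^+ #|[set w in X | adj E v w]|) =
  (p * a + (1 - p)) ^+ #|X|.
Proof.
move=> vX; pose e (w : {w | w \in X}) := [set v; val w].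
have ve (w : {w | w \in X}) : v != val w by case: w => w /= wX; apply: contraNneq vX => ->.
have inje : injective e.
  move=> w w' /setP/(_ (val w)); rewrite !inE eqxx orbT eq_sym (negbTE (ve _)).
  by move=> /esym/eqP/val_inj.
rewrite (@eq_subset_mean _ _ _ _ _ (fun E => \prod_w (if e w \in E then a else 1))).
  rewrite (subset_mean_edges _ (fun _ b => if b then a else 1))//=.
    by rewrite mulr1 prodr_const card_sig.
  by move=> w; rewrite inE cards2 ve.
move=> E; rewrite -(big_sub (mem X) (fun w => if adj E v w then a else 1)).
rewrite -big_mkcondr/= prodr_const; congr (_ ^+ _).
by apply: eq_card => w; rewrite !inE.
Qed.

Lemma cardC_ord (T : {set 'I_n}) : #|~: T| = (n - #|T|)%N.
Proof. by rewrite cardsCs setCK card_ord. Qed.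

(* With [T = T1 = [set u; v]], the event is that [u] and [v] have no common
   neighbour. *)
Lemma gnp_prob_extension (T T1 : {set 'I_n}) :
  gnp_prob n p (fun E => [forall w, (w \notin T) ==>
      ~~ [forall t in T, adj E w t == (t \in T1)]]) =
  (1 - \prod_(t in T) (if t \in T1 then p else 1 - p)) ^+ (n - #|T|).
Proof.
pose J := {w | w \in ~: T}; pose W := {t | t \in T}.
have xu (j : J) (a : W) : val j != val a.
  by case: j a => j /= jT [a /= aT]; apply: contraTneq jT => ->; rewrite inE negbK.
pose S1 : {set W} := [set a | val a \in T1].
rewrite gnp_probE (@eq_subset_mean _ _ _ _ _ (fun E =>
  \prod_j (pattern (val : J -> _) (val : W -> _) E j != S1)%:R)); last first.
  move=> E; case: forallP => [noext|/forallP/forallPn[w]]; last first.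
    rewrite negb_imply negbK => /andP[wT /forall_inP wext].
    have wJ : w \in ~: T by rewrite inE.
    rewrite (bigD1 (exist _ w wJ))//= ffunE (_ : [set _ | _] = S1) ?eqxx ?mul0r//.
    by apply/setP => a; rewrite !inE /=; apply/eqP/wext; exact: valP a.
  rewrite big1// => j _; rewrite (_ : _ != _)//.
  apply/negP => /eqP/setP js; have := noext (val j); rewrite -in_setC (valP j) /=.
  move/negP; apply; apply/forall_inP => t tT.
  by have := js (exist _ t tT); rewrite ffunE !inE /= => ->.
rewrite (subset_mean_pattern_prod _ val_inj val_inj xu (fun S => (S != S1)%:R)).
rewrite card_sig; have -> : #|[pred w | w \in ~: T]| = (n - #|T|)%N.
  by rewrite -cardC_ord; apply: eq_card => w; rewrite !inE.
congr (_ ^+ _); have := sum_pattern_weight p W.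
rewrite (bigD1 S1)//= => /esym/eqP; rewrite addrC -subr_eq => /eqP wS1.
rewrite (bigD1 S1)//= eqxx mulr0 add0r.
rewrite (eq_bigr (fun S => pattern_weight p S)) => [|S SS1]; last by rewrite SS1 mulr1.
rewrite -wS1; congr (_ - _).
rewrite (big_sub (mem T) (fun t => if t \in T1 then p else 1 - p)).
by apply: eq_bigr => a _; rewrite inE.
Qed.

Lemma subset_mean_separated (u v : 'I_n) (a : R) : u != v ->
  subset_mean (vertex_pairs n) p (fun E =>
    a ^+ #|[set w in ~: [set u; v] | adj E w u != adj E w v]|) =
  (1 - 2 * p * (1 - p) * (1 - a)) ^+ (n - 2).
Proof.
move=> uv; pose J := {w | w \in ~: [set u; v]}.
pose g (b : bool) := if b then u else v.
have injg : injective g by case=> -[]// /eqP; rewrite /g ?(negbTE uv) // eq_sym (negbTE uv).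
have xu (j : J) b : val j != g b.
  by case: j => j /= jT; apply: contraTneq jT => ->; rewrite !inE /g; case: b; rewrite eqxx ?orbT.
pose h (S : {set bool}) := if (true \in S) != (false \in S) then a else 1.
rewrite (@eq_subset_mean _ _ _ _ _ (fun E =>
  \prod_j h (pattern (val : J -> _) g E j))); last first.
  move=> E; under eq_bigr do rewrite /h ffunE !inE.
  rewrite -(big_sub (mem (~: [set u; v])) (fun w => if adj E w u != adj E w v then a else 1)).
  rewrite -big_mkcondr/= prodr_const; congr (_ ^+ _).
  by apply: eq_card => w; rewrite !inE [RHS]unfold_in/= !inE.
rewrite (subset_mean_pattern_prod _ val_inj injg xu h) card_sig.
have -> : #|[pred w | w \in ~: [set u; v]]| = (n - 2)%N.
  have := cards2 u v; rewrite uv => <-.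
  by rewrite -cardC_ord; apply: eq_card => w; rewrite !inE.
congr (_ ^+ _); have := sum_pattern_weight p bool.
have ntf : [set false] != [set true] by apply/eqP => /setP/(_ true); rewrite !inE.
rewrite (bigD1 [set true])//= (bigD1 [set false])//=.
rewrite [X in _ -> X = _](bigD1 [set true])//= [X in _ -> _ + X = _](bigD1 [set false])//=.
rewrite {1 2}/h !inE /= [X in _ -> _ + (_ + X) = _](eq_bigr (fun S => pattern_weight p S)); last first.
  move=> S /andP[S1 S2]; rewrite /h ifF ?mulr1//; apply/negbTE; rewrite negbK.
  apply/eqP; case tS: (true \in S); case fS: (false \in S) => //.
    by case/eqP: S1; apply/setP => -[]; rewrite !inE ?tS ?fS.
  by case/eqP: S2; apply/setP => -[]; rewrite !inE ?tS ?fS.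
have -> : pattern_weight p [set true] = p * (1 - p) by rewrite /pattern_weight big_bool !inE.
have -> : pattern_weight p [set false] = p * (1 - p).
  by rewrite /pattern_weight big_bool !inE mulrC.
move: (\sum_(_ | _) _) => s hs; have -> : s = 1 - 2 * (p * (1 - p)) by lra.
by ring.
Qed.

Lemma gnp_prob_injective_nbr (v : 'I_n) (W : {set 'I_n}) : v \notin W ->
  let r := Num.sqrt ((p ^+ 2 + (1 - p) ^+ 2) ^+ #|W|) in
  gnp_prob n p (fun E => [forall x, forall y,
    [&& adj E v x, adj E v y, x \notin v |: W, y \notin v |: W &
        [forall w in W, adj E x w == adj E y w]] ==> (x == y)]) <=
  expR 1 * n.+1%:R * expR 2^-1 * (p * expR (- (r / 4)) + (1 - p)) ^+ (n - #|W|.+1).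
Proof.
move=> vW; set r := Num.sqrt _ => /=; pose X := ~: (v |: W).
pose star : {set {set 'I_n}} := [set e : {set 'I_n} | v \in e].
pose JE E := [set x in X | adj E v x].
pose inj (J : {set 'I_n}) E := [forall x in J, forall y in J,
  [forall w in W, adj E x w == adj E y w] ==> (x == y)].
set B := expR 1 * n.+1%:R * expR 2^-1; set a := expR (- (r / 4)).
have B0 : 0 <= B by rewrite !mulr_ge0 ?expR_ge0.
have injB (J : {set 'I_n}) : J \subset X -> gnp_prob n p (inj J) <= B * a ^+ #|J|.
  move=> /subsetP JX; have xu (x : {x | x \in J}) (w : {w | w \in W}) : val x != val w.
    case: x w => x /= xJ [w /= wW]; apply: contraTneq wW => <-.
    by have := JX _ xJ; rewrite !inE negb_or => /andP[].
  have := gnp_injective_pattern val_inj val_inj xu p01.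
  rewrite !card_sig -/r => /le_trans h.
  apply: le_trans (gnp_prob_mono _) (h _ _) => [E /forall_inP injE|].
    apply/injectiveP => -[x xJ] [y yJ]; rewrite !ffunE => /setP xy; apply/val_inj/eqP.
    have /forall_inP/(_ y yJ)/implyP := injE x xJ; apply; apply/forall_inP => w wW.
    by have := xy (exist _ w wW); rewrite !inE /= => ->.
  rewrite /B -!mulrA ler_wpM2l ?expR_ge0// ler_pM ?mulr_ge0 ?expR_ge0//.
    by rewrite ler_nat ltnS -[leqRHS]card_ord max_card.
  rewrite -expRM_natl -expRD ler_expR /a.
  by rewrite le_eqVlt; apply/orP; left; apply/eqP; ring.
have indep (J : {set 'I_n}) : J \subset X ->
  subset_mean (vertex_pairs n) p (fun E => (JE E == J)%:R * (inj J E)%:R) =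
  subset_mean (vertex_pairs n) p (fun E => (JE E == J)%:R) * gnp_prob n p (inj J).
  move=> /subsetP JX; rewrite gnp_probE; apply: (@subset_mean_indep _ _ _ _ star) => E.
    congr ((_ == _)%:R); apply/setP => x.
    by rewrite !inE /adj !inE eqxx /= andbT.
  congr (nat_of_bool _)%:R; apply: eq_forallb_in => x xJ; apply: eq_forallb_in => y yJ.
  congr (_ ==> _); apply: eq_forallb_in => w wW.
  have nv z : z \in J -> ([set z; w] \in E :\: star) = ([set z; w] \in E).
    move=> /JX; rewrite !inE negb_or eq_sym => /andP[/negbTE-> _].
    by rewrite (negbTE (_ : v != w))//; apply: contraNneq vW => ->.
  by rewrite /adj !nv.
apply: le_trans (_ : subset_mean (vertex_pairs n) p (fun E =>
  \sum_(J in powerset X) (JE E == J)%:R * (inj J E)%:R) <= _).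
  apply: gnp_prob_markov => [E|E /forallP/= h]; first by rewrite sumr_ge0.
  have JEX : JE E \in powerset X by rewrite powersetE; apply/subsetP => x; rewrite inE => /andP[].
  rewrite (bigD1 (JE E))//= eqxx mul1r; set b := inj _ _.
  suff -> : b by rewrite lerDl sumr_ge0.
  apply/forall_inP => x; rewrite 2!inE => /andP[xX vx].
  apply/forall_inP => y; rewrite 2!inE => /andP[yX vy].
  apply/implyP => same; have /forallP/(_ y)/implyP := h x; apply.
  by rewrite vx vy xX yX.
rewrite subset_mean_sum.
apply: le_trans (_ : \sum_(J in powerset X) subset_mean (vertex_pairs n) p
  (fun E => B * ((JE E == J)%:R * a ^+ #|J|)) <= _).
  apply: ler_sum => J; rewrite powersetE => JX; rewrite indep// subset_meanZ.
  rewrite mulrC [X in _ <= _ * X](@eq_subset_mean _ _ _ _ _ (fun E => a ^+ #|J| * (JE E == J)%:R)); last first.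
    by move=> E; rewrite mulrC.
  rewrite subset_meanZ mulrA ler_wpM2r ?injB// -gnp_probE gnp_prob_ge0//.
rewrite -subset_mean_sum (@eq_subset_mean _ _ _ _ _ (fun E => B * a ^+ #|JE E|)).
  rewrite subset_meanZ subset_mean_degree ?inE ?eqxx// cardC_ord cardsU1 vW add1n.
  exact: lexx.
move=> E; have JEX : JE E \in powerset X by rewrite powersetE; apply/subsetP => x; rewrite inE => /andP[].
rewrite (bigD1 (JE E))//= eqxx mul1r big1 ?addr0// => J /andP[_].
by rewrite eq_sym => /negbTE ->; rewrite mul0r mulr0.
Qed.

End GnpEstimates.

(** * The localization game *)

Section Game.
Variables (V : finType) (G : rel V).
Hypothesis symG : symmetric G.

Lemma signature_eqP (W : {set V}) x y :
  reflect (forall w, w \in W -> dist G x w = dist G y w)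
          (signature G W x == signature G W y).
Proof.
apply: (iffP eqP) => [/eq_in_map h w wW|h]; first by apply: h; rewrite mem_enum.
by apply/eq_in_map => w; rewrite mem_enum => /h.
Qed.

Lemma signatureU1 (W : {set V}) w x y :
  (signature G (w |: W) x == signature G (w |: W) y) =
  (dist G x w == dist G y w) && (signature G W x == signature G W y).
Proof.
apply/signature_eqP/andP => [h|[/eqP hw /signature_eqP hW] z].
  split; first by apply/eqP/h; rewrite setU11.
  by apply/signature_eqP => z zW; apply: h; rewrite setU1r.
by case/setU1P => [->//|/hW].
Qed.

Lemma signature_sub (W W' : {set V}) x y : W \subset W' ->
  signature G W' x == signature G W' y -> signature G W x == signature G W y.
Proof.
by move=> /subsetP sub /signature_eqP h; apply/signature_eqP => w /sub/h.
Qed.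

Lemma walk_of_length1 u v : walk_of_length G 1 u v = G u v.
Proof.
apply/existsP/idP => [[s]|uv]; last by exists [tuple v]; rewrite /= uv eqxx.
by case/tupleP: s => a s; rewrite tuple0 /= andbT => /andP[uv /eqP <-].
Qed.

Lemma dist_eq1 u v : (dist G u v == 1%N) = (u != v) && G u v.
Proof.
have [->|uv] := eqVneq u v.
  have /eqP -> : dist G v v == 0%N by rewrite dist_eq0.
  by [].
have d0 := dist_eq0 G u v; rewrite (negbTE uv) in d0.
have : (1 < #|V|)%N.
  by rewrite -cardsT (cardD1 u) inE (cardD1 v) !inE eq_sym uv.
move: d0; rewrite /dist; case: #|V| => [|[|m]]//= d0 _.
case: ifP d0 => // _ _ /=.
by rewrite walk_of_length1; case: ifP.
Qed.

Lemma dist_le2 u v w : u != v -> G u w -> G w v -> (dist G u v <= 2)%N.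
Proof.
move=> uv uw wv; have [wv'|wv'] := eqVneq w v.
  by subst w; have := dist_eq1 u v; rewrite uv uw => /eqP ->.
have [wu|wu] := eqVneq w u.
  by subst w; have := dist_eq1 u v; rewrite uv wv => /eqP ->.
have : (2 < #|V|)%N.
  by rewrite -cardsT (cardD1 u) inE (cardD1 v) (cardD1 w) !inE (eq_sym v) uv wu wv'.
rewrite /dist; case: #|V| => [|[|[|m]]]//= _.
case: ifP => // _; case: ifP => // _; rewrite ifT//.
by apply/existsP; exists [tuple w; v]; rewrite /= uw wv eqxx.
Qed.

Lemma dist_neq_adj x y w : w != x -> w != y -> G w x != G w y ->
  dist G x w != dist G y w.
Proof.
move=> wx wy; apply: contraNneq => e; apply/eqP.
have := dist_eq1 x w; rewrite e dist_eq1.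
by rewrite ![_ == w]eq_sym wx wy /= => /esym; rewrite ![G _ w]symG.
Qed.

Lemma dist_eq_adj x y w : w != x -> w != y ->
  (forall u v, u != v -> G u v || [exists z, G u z && G z v]) ->
  G w x = G w y -> dist G x w = dist G y w.
Proof.
move=> wx wy diam e.
suff d z : w != z -> dist G z w = if G w z then 1%N else 2%N by rewrite !d// e.
move=> wz; have := dist_eq1 z w; rewrite (eq_sym z) wz /= symG.
case: ifP => [_ /eqP//|nwz d1].
have := dist_eq0 G z w; rewrite (eq_sym z) (negbTE wz) => d0.
have := diam z w; rewrite (eq_sym z) wz symG nwz => /(_ isT)/existsP[u /andP[zu uw]].
have := @dist_le2 z w u; rewrite (eq_sym z) wz => /(_ isT zu uw).
by case: (dist G z w) d0 d1 => [|[|[|]]].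
Qed.

Definition move_set (S : {set V}) : {set V} :=
  [set y | [exists x in S, robber_step G x y]].

Lemma move_setT : move_set setT = setT.
Proof.
apply/setP => y; rewrite !inE; apply/exists_inP.
have [w yw|iso] := pickP (G y).
  by exists w; rewrite ?inE// /robber_step symG yw.
by exists y; rewrite ?inE// /robber_step eqxx orbC /=; apply/orP; left; apply/forallP => w; rewrite iso.
Qed.

Lemma cop_wins_shrinking (k : nat) : (k <= #|V|)%N ->
  (forall S : {set V}, (1 < #|S|)%N -> exists2 W : {set V}, #|W| = k &
     forall c, (#|[set x in move_set S | signature G W x == c]| < #|S|)%N) ->
  cop_wins G k.
Proof.
move=> kV shrink.
have /choice[Wf WfP] : forall S : {set V}, exists W : {set V}, #|W| = k /\
   ((1 < #|S|)%N -> forall c, (#|[set x in move_set S | signature G W x == c]| < #|S|)%N).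
  move=> S; have [S1|S1] := ltnP 1 #|S|.
    by have [W Wk WS] := shrink S S1; exists W.
  have : (0 < #|[set A : {set V} | #|A| == k]|)%N by rewrite card_draws bin_gt0.
  by case/card_gt0P => W; rewrite inE => /eqP Wk; exists W.
pose C := foldl (fun S c => [set x in move_set S | signature G (Wf S) x == c]) setT.
have CE h c : C (rcons h c) = [set x in move_set (C h) | signature G (Wf (C h)) x == c].
  by rewrite /C -cats1 foldl_cat.
pose s h := Wf (C h).
exists s; split=> [h|r rw]; first by case: (WfP (C h)).
have inv r' : robber_walk G r' -> forall t, r' t \in C (history G s r' t.+1).
  move=> rw'; suff pre t : r' t \in move_set (C (history G s r' t)).
    by move=> t; rewrite /= CE inE pre eqxx.
  elim: t => [|t IH]; first by rewrite move_setT inE.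
  by rewrite inE; apply/exists_inP; exists (r' t); rewrite //= CE inE IH eqxx.
pose c t := #|C (history G s r t.+1)|.
have [t ct] : exists t, (c t <= 1)%N.
  apply: contrapT => /forallNP h.
  have {}h t : (1 < c t)%N by rewrite ltnNge; apply/negP/h.
  have dec t : (c t + t <= c 0)%N.
    elim: t => [|t IH]; first by rewrite addn0.
    apply: leq_trans IH; rewrite addnS -addSn leq_add2r.
    by rewrite /c [history G s r t.+2]/= CE; apply: (WfP _).2; exact: h.
  by have := dec (c 0%N); have := h (c 0%N); lia.
exists t => r' rw' hist; move/card_le1_eqP: ct; apply; first exact: inv.
by rewrite -hist; exact: inv.
Qed.

Lemma eq_history (s : seq (seq nat) -> {set V}) r r' t :
  (forall i, (i < t)%N -> r i = r' i) -> history G s r t = history G s r' t.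
Proof.
elim: t => [//|t IH] h /=; rewrite IH => [|i it]; last by apply: h; rewrite ltnS ltnW.
by rewrite h.
Qed.

Lemma robber_escapes (k : nat) (v0 : V) :
  (forall v (W : {set V}), #|W| = k -> exists x y, [/\ x != y, G v x, G v y &
     signature G W x = signature G W y]) ->
  ~ cop_wins G k.
Proof.
move=> collide [s [sk win]].
have /choice[f fP] : forall vh : V * seq (seq nat), exists xy : V * V,
    [/\ xy.1 != xy.2, G vh.1 xy.1, G vh.1 xy.2 &
     signature G (s vh.2) xy.1 = signature G (s vh.2) xy.2].
  move=> [v h]; have [x [y xyP]] := collide v (s h) (sk h).
  by exists (x, y).
pose next vh := ((f vh).1, rcons vh.2 (signature G (s vh.2) (f vh).1)).
(* The first component is the position before the move of round [t], the second
   the signatures received before that round. *)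
pose st t := iter t next (v0, [::]).
pose r t := (f (st t)).1.
have st1 t : (st t.+1).1 = r t by [].
have hist t : history G s r t = (st t).2.
  by elim: t => [//|t IH] /=; rewrite IH.
have rw : robber_walk G r.
  by move=> t; rewrite /robber_step; have [_ + _ _] := fP (st t.+1); rewrite st1 => ->.
have [t] := win r rw.
have [neq adjr adjr' same] := fP (st t).
pose succ y := odflt y [pick w | G y w].
have succP y : robber_step G y (succ y).
  rewrite /succ /robber_step; case: pickP => [w -> //|iso] /=.
  by rewrite eqxx orbC /=; apply/orP; left; apply/forallP => w; rewrite iso.
pose r' i := if (i < t)%N then r i else iter (i - t) succ (f (st t)).2.
have rr' i : (i < t)%N -> r i = r' i by rewrite /r' => ->.
have r't : r' t = (f (st t)).2 by rewrite /r' ltnn subnn.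
have rw' : robber_walk G r'.
  move=> i; have [it|ti] := ltnP i.+1 t.
    by rewrite -!rr'// ltnW.
  have [e|ti'] := eqVneq i.+1 t.
    rewrite e r't -rr' -?e//; subst t.
    by rewrite /robber_step -st1 adjr'.
  have le_ti : (t <= i)%N by move: ti; rewrite leq_eqVlt eq_sym (negbTE ti') ltnS.
  by rewrite /r' !ltnNge le_ti (leqW le_ti) /= subSn//=; exact: succP.
move=> /(_ r' rw'); rewrite r't => loc; case/eqP: neq; apply/esym/loc.
by rewrite /= -(eq_history _ rr') r't hist same.
Qed.

Lemma localization_number_le (k : nat) : cop_wins G k -> (localization_number G <= k)%N.
Proof.
by move=> win; rewrite /localization_number; case: ex_minnP => m _; apply; apply/asboolP.
Qed.

Lemma localization_number_gt (k : nat) :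
  (forall i, (i <= k)%N -> ~ cop_wins G i) -> (k < localization_number G)%N.
Proof.
move=> lose; rewrite /localization_number; case: ex_minnP => m /asboolP win _.
by rewrite ltnNge; apply/negP => /lose.
Qed.

End Game.

Section Greedy.
Variables (V : finType) (G : rel V) (R : realType).

Definition collisions (A W : {set V}) : {set V * V} :=
  [set q in setX A A | (q.1 != q.2) && (signature G W q.1 == signature G W q.2)].

Lemma collisions_sub A (W W' : {set V}) : W \subset W' ->
  collisions A W' \subset collisions A W.
Proof.
move=> WW'; apply/subsetP => q; rewrite !inE => /and3P[-> -> /=].
exact: signature_sub.
Qed.

Lemma card_class_collisions (A W : {set V}) c :
  (#|[set x in A | signature G W x == c]| * (#|[set x in A | signature G W x == c]|).-1
    <= #|collisions A W|)%N.
Proof.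
set C := [set x in A | _].
have diagE : [set q in setX C C | q.1 == q.2] = [set (x, x) | x in C].
  apply/setP => -[x y]; rewrite !inE /=; apply/andP/imsetP.
    by case=> /andP[xC _] /eqP <-; exists x; rewrite ?inE.
  by case=> z zC [-> ->]; rewrite !inE in zC; rewrite zC eqxx.
have cardC : #|[set q in setX C C | q.1 == q.2]| = #|C|.
  by rewrite diagE card_imset// => x y [].
have : [set q in setX C C | q.1 != q.2] \subset collisions A W.
  apply/subsetP => -[x y]; rewrite !inE /= => /andP[/andP[/andP[-> /eqP->] /andP[-> /eqP->]] ->].
  by rewrite eqxx.
move/subset_leq_card; apply: leq_trans.
have := cardsID [set q | q.1 == q.2] (setX C C); rewrite cardsX.
rewrite (_ : _ :&: _ = [set q in setX C C | q.1 == q.2]); last by apply/setP => q; rewrite !inE.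
rewrite (_ : _ :\: _ = [set q in setX C C | q.1 != q.2]); last by apply/setP => q; rewrite !inE andbC.
by rewrite cardC; case: #|C| => [|m] /=; nia.
Qed.

Lemma greedy_collisions (sigma : R) (A : {set V}) (i : nat) :
  (0 < #|V|)%N -> 0 <= sigma <= 1 ->
  (forall x y, x != y -> sigma * #|V|%:R <= #|[set w | dist G x w != dist G y w]|%:R) ->
  exists2 W : {set V}, (#|W| <= i)%N &
    #|collisions A W|%:R <= #|A|%:R ^+ 2 * (1 - sigma) ^+ i :> R.
Proof.
move=> V0 /andP[s0 s1] sep; elim: i => [|i [W Wi IH]].
  exists set0; first by rewrite cards0.
  rewrite expr0 mulr1 -natrX ler_nat -mulnn -cardsX subset_leq_card//.
  by apply/subsetP => q; rewrite inE => /andP[].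
suff [w hw] : exists w, #|collisions A (w |: W)|%:R <= (1 - sigma) * #|collisions A W|%:R :> R.
  exists (w |: W); first by rewrite cardsU1; case: (w \notin W); lia.
  by apply: le_trans hw _; rewrite [X in _ <= _ * X]exprS mulrCA ler_wpM2l// subr_ge0.
apply: contrapT => /forallNP none.
have {}none w : (1 - sigma) * #|collisions A W|%:R < #|collisions A (w |: W)|%:R :> R.
  by rewrite ltNge; apply/negP/none.
have : \sum_(w : V) (1 - sigma) * #|collisions A W|%:R <
       \sum_(w : V) #|collisions A (w |: W)|%:R :> R.
  apply: ltr_sum => //; case/card_gt0P: V0 => x _.
  by apply/hasP; exists x; rewrite ?mem_index_enum.
apply/negP; rewrite -leNgt sumr_const.
have -> : \sum_(w : V) #|collisions A (w |: W)|%:R =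
    \sum_(q in collisions A W) #|[set w | dist G q.1 w == dist G q.2 w]|%:R :> R.
  rewrite -!natr_sum; congr _%:R.
  under eq_bigr do rewrite -sum1_card.
  under [RHS]eq_bigr do rewrite -sum1_card.
  rewrite (exchange_big_dep (mem (collisions A W)))/=; last first.
    by move=> w q _; apply: subsetP; rewrite collisions_sub// subsetUr.
  apply: eq_bigr => q; rewrite !inE => /and3P[qA q12 qW]; apply: eq_bigl => w.
  by rewrite !inE qA q12 signatureU1 qW andbT.
have -> : (1 - sigma) * #|collisions A W|%:R *+ #|V| =
    \sum_(q in collisions A W) (1 - sigma) * #|V|%:R :> R.
  by rewrite sumr_const -[LHS]mulr_natr -[RHS]mulr_natr mulrAC.
apply: ler_sum => q; rewrite inE => /and3P[_ q12 _].
have := sep _ _ q12; have := cardsC [set w | dist G q.1 w == dist G q.2 w].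
rewrite (_ : ~: _ = [set w | dist G q.1 w != dist G q.2 w]); last first.
  by apply/setP => w; rewrite !inE.
move=> /(congr1 (fun m => m%:R : R)); rewrite natrD mulrBl mul1r => <-.
by rewrite lerBrDr lerD2l.
Qed.

End Greedy.

Lemma exists_superset_card (T : finType) (A : {set T}) (k : nat) :
  (#|A| <= k <= #|T|)%N -> exists2 B : {set T}, A \subset B & #|B| = k.
Proof.
move=> /andP[Ak kT]; elim: k Ak kT => [|k IH] Ak kT.
  by exists A => //; apply/eqP; rewrite -leqn0.
move: Ak; rewrite leq_eqVlt => /predU1P[Ak|]; first by exists A.
rewrite ltnS => /IH/(_ (ltnW kT))[B AB Bk].
have : (0 < #|~: B|)%N by rewrite cardsCs setCK Bk subn_gt0.
case/card_gt0P => x; rewrite inE => xB; exists (x |: B).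
  by rewrite (subset_trans AB)// subsetUr.
by rewrite cardsU1 xB Bk.
Qed.

Lemma leq_card_family (T I : finType) (S : {set I}) (B : I -> {set T}) (M : {set T}) :
  (forall y, y \in M -> exists2 v, v \in S & y \in B v) ->
  (#|M| <= \sum_(v in S) #|B v|)%N.
Proof.
move=> cover; under [leqRHS]eq_bigr do rewrite -sum1_card.
rewrite (exchange_big_dep xpredT)//= -sum1_card [leqLHS]big_mkcond/=.
apply: leq_sum => y _; case: ifP => // /cover[v vS yB].
by rewrite (bigD1 v)//= vS.
Qed.

Section Deterministic.
Variables (n : nat) (E : {set {set 'I_n}}).
Local Notation G := (adj E).

Lemma adj_sym : symmetric G.
Proof. by move=> u v; rewrite /adj setUC. Qed.

Lemma localization_number_adj_gt (K : nat) : (0 < n)%N -> (K <= n)%N ->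
  (forall u v, u != v -> G u v || [exists z, G u z && G z v]) ->
  (forall v (W : {set 'I_n}), #|W| = K -> exists x y, [/\ x != y, G v x, G v y,
     (x \notin v |: W) && (y \notin v |: W) &
     {in W :\ v, forall w, G x w = G y w}]) ->
  (K < localization_number G)%N.
Proof.
move=> n0 Kn diam coll; apply: localization_number_gt => i iK.
apply: (robber_escapes (Ordinal n0)) => v W Wi.
have [|W2 WW2 W2K] := @exists_superset_card _ W K; first by rewrite Wi iK card_ord.
have [x [y [xy vx vy /andP[xW yW] same]]] := coll v W2 W2K.
exists x, y; split=> //; apply/eqP; apply: signature_sub WW2 _.
apply/signature_eqP => w wW2.
have [wx wy] : w != x /\ w != y.
  by split; [apply: contraNneq xW|apply: contraNneq yW] => <-; rewrite setU1r.
apply: dist_eq_adj => //; first exact: adj_sym.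
have [->|wv] := eqVneq w v; first by rewrite vx vy.
by rewrite ![G w _]adj_sym same// !inE wv.
Qed.

Variable R : realType.
Variable sigma : R.
Hypotheses (n0 : (0 < n)%N) (sigma01 : 0 <= sigma <= 1).
Hypothesis separated : forall u v, u != v ->
  sigma * n%:R <= #|[set w in ~: [set u; v] | G w u != G w v]|%:R.

Lemma greedy_collisions_adj (A : {set 'I_n}) (i : nat) :
  exists2 W : {set 'I_n}, (#|W| <= i)%N &
    #|collisions G A W|%:R <= #|A|%:R ^+ 2 * (1 - sigma) ^+ i :> R.
Proof.
apply: greedy_collisions; rewrite ?card_ord// => x y xy.
apply: le_trans (separated xy) _; rewrite ler_nat subset_leq_card//.
apply/subsetP => w; rewrite !inE negb_or => /andP[/andP[wx wy] Gw].
exact: dist_neq_adj adj_sym _ _ _ wx wy Gw.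
Qed.

Lemma cop_wins_sparse (d : R) (k : nat) : (k <= n)%N -> 0 <= d ->
  (forall v, #|[set w in ~: [set v] | G v w]|%:R <= d) ->
  (d + 1) ^+ 2 * (1 - sigma) ^+ k < 2^-1 ->
  cop_wins G k.
Proof.
move=> kn d0 deg small; apply: (cop_wins_shrinking adj_sym) => [|S S1].
  by rewrite card_ord.
have [W Wk coll] := greedy_collisions_adj (move_set G S) k.
have [|W2 WW2 W2k] := @exists_superset_card _ W k; first by rewrite Wk card_ord.
exists W2 => // c; rewrite ltnNge; apply/negP => Sle.
have cardm : #|move_set G S|%:R <= #|S|%:R * (d + 1).
  apply: le_trans (_ : (\sum_(v in S) #|v |: [set w in ~: [set v] | G v w]|)%:R <= _).
    rewrite ler_nat; apply: leq_card_family => y; rewrite inE => /exists_inP[v vS vy].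
    exists v => //; rewrite !inE; have [//|yv] := eqVneq y v.
    by case/orP: vy => // /andP[/eqP vy]; rewrite vy eqxx in yv.
  rewrite natr_sum mulr_natl -sumr_const; apply: ler_sum => v _.
  by rewrite cardsU1 !inE eqxx/= add1n -natr1 lerD2r; exact: deg.
have := leq_trans (card_class_collisions G (move_set G S) W2 c)
  (subset_leq_card (collisions_sub _ _ WW2)).
move: Sle; set s' := #|[set x in _ | _]| => Sle s'coll.
have : (#|S| * #|S| <= 2 * #|collisions G (move_set G S) W|)%N.
  apply: leq_trans (_ : 2 * (s' * s'.-1) <= _)%N; last by rewrite leq_mul2l.
  have m1 : (2 <= s')%N by exact: leq_trans Sle.
  apply: leq_trans (leq_mul Sle Sle) _.
  by case: s' m1 {Sle s'coll} => [|m]//=; rewrite ltnS; nia.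
rewrite -(ler_nat R) !natrM -expr2; apply/negP; rewrite -ltNge.
have s0 : 0 < #|S|%:R ^+ 2 :> R by rewrite exprn_gt0// ltr0n ltnW.
apply: le_lt_trans (_ : 2 * (#|S|%:R ^+ 2 * ((d + 1) ^+ 2 * (1 - sigma) ^+ k)) < _).
  rewrite ler_wpM2l// (le_trans coll)// mulrA -exprMn ler_wpM2r//.
    by rewrite exprn_ge0// subr_ge0; case/andP: sigma01.
  by rewrite lerXn2r// nnegrE ?mulr_ge0// addr_ge0.
rewrite mulrCA gtr_pMr//; lra.
Qed.

Lemma cop_wins_dense (i m : nat) : (i + m <= n)%N -> (4 ^ m <= n)%N ->
  n%:R ^+ 2 * (1 - sigma) ^+ i <= 4 ^+ m ->
  (forall T T1 : {set 'I_n}, #|T| = (4 ^ m)%N ->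
     exists2 w, w \notin T & {in T, forall t, G w t = (t \in T1)}) ->
  cop_wins G (i + m).
Proof.
move=> imn mn few ext; have [W Wi coll] := greedy_collisions_adj setT i.
have {}coll : (#|collisions G setT W| <= 4 ^ m)%N.
  by rewrite -(ler_nat R) natrX (le_trans coll)// cardsT card_ord.
pose cls x := [set y in setT | signature G W y == signature G W x].
have clsm x : (#|cls x| <= 2 ^ m)%N.
  have := leq_trans (card_class_collisions G setT W (signature G W x)) coll.
  rewrite -/(cls x) -[4%N]/(2 * 2)%N expnMn.
  have : (0 < 2 ^ m)%N by rewrite expn_gt0.
  case: #|cls x| => [|s] //= M0 sM; rewrite leqNgt; apply/negP => Ms.
  have := leq_trans (leq_mul Ms (leqnn s)) sM.
  by have := leq_mul (leqnn (2 ^ m).+1) (Ms : (2 ^ m <= s)%N); nia.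
have [|T T0T TM] := @exists_superset_card _ [set q.1 | q in collisions G setT W] (4 ^ m).
  by rewrite (leq_trans (leq_imset_card _ _))// card_ord.
(* Distinct vertices of the same class get distinct labels in [{set 'I_m}], and
   the [j]-th additional vertex reads off whether [j] is in the label. *)
pose label x := nth set0 (enum {set 'I_m}) (index x (enum (cls x))).
have size_label : size (enum {set 'I_m}) = (2 ^ m)%N.
  rewrite -cardE -[in RHS](card_ord m) -[#|'I_m|]cardsT -card_powerset.
  by apply: eq_card => A; rewrite powersetE subsetT.
have idx x : (index x (enum (cls x)) < 2 ^ m)%N.
  by rewrite (leq_trans _ (clsm x))// cardE index_mem mem_enum !inE eqxx.
have /choice[w wP] : forall j : 'I_m, exists w, w \notin T /\
    {in T, forall t, G w t = (j \in label t)}.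
  move=> j; have [w wT wt] := ext T [set t | j \in label t] TM.
  by exists w; split=> // t tT; rewrite wt// inE.
have [|W2 WW2 W2k] := @exists_superset_card _ (W :|: [set w j | j in 'I_m]) (i + m).
  rewrite card_ord imn andbT (leq_trans (leq_card_setU _ _))// leq_add//.
  by rewrite (leq_trans (leq_imset_card _ _))// card_ord.
have inj x y : signature G W2 x = signature G W2 y -> x = y.
  move=> sxy; apply: contrapT => /eqP xy.
  have sW : signature G W x == signature G W y.
    by apply: signature_sub (subset_trans (subsetUl _ _) WW2) _; apply/eqP.
  have inT a b : a != b -> signature G W a == signature G W b -> a \in T.
    move=> ab sab; apply: (subsetP T0T); apply/imsetP; exists (a, b) => //.
    by rewrite !inE ab.
  have xT := inT _ _ xy sW.
  have yT : y \in T by apply: (inT y x); rewrite 1?eq_sym.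
  have clsE : cls x = cls y.
    by apply/setP => z; rewrite !inE (eqP sW).
  have : label x = label y.
    apply/setP => j; have [wT wt] := wP j; rewrite -!wt//.
    have wW2 : w j \in W2 by rewrite (subsetP WW2)// !inE imset_f ?orbT.
    have [wx wy] : w j != x /\ w j != y.
      by split; apply: contraNneq wT => ->.
    apply/eqP; apply: contraT => /(dist_neq_adj adj_sym wx wy)/eqP; case.
    by move/eqP/signature_eqP: sxy; apply.
  rewrite /label clsE => /eqP; rewrite nth_uniq ?enum_uniq//.
  - have xc : x \in enum (cls y) by rewrite mem_enum !inE.
    have yc : y \in enum (cls y) by rewrite mem_enum !inE eqxx.
    by move=> /eqP/(congr1 (nth x (enum (cls y)))); rewrite !nth_index// => /eqP; rewrite (negbTE xy).
  - by rewrite size_label -clsE idx.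
  - by rewrite size_label idx.
apply: (cop_wins_shrinking adj_sym); first by rewrite card_ord.
move=> S S1; exists W2 => // c; apply: leq_ltn_trans S1.
apply/card_le1_eqP => x y; rewrite !inE => /andP[_ /eqP xc] /andP[_ /eqP yc].
by apply: inj; rewrite xc yc.
Qed.

End Deterministic.

Lemma bin_le_expn (n k : nat) : ('C(n, k) <= n ^ k)%N.
Proof.
apply: (@leq_trans (n ^_ k)).
  by rewrite -bin_ffact leq_pmulr// fact_gt0.
elim: k => [//|k IH]; rewrite ffactnSr expnSr; exact: leq_mul IH (leq_subr _ _).
Qed.

(** * Tail bounds for the localization number *)

Section UnionBounds.
Variables (R : realType) (n : nat) (p : R).
Hypothesis p01 : 0 <= p <= 1.
Implicit Types (E : {set {set 'I_n}}) (A B : pred {set {set 'I_n}}).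

Lemma gnp_prob_or A B C : (forall E, A E -> B E || C E) ->
  gnp_prob n p A <= gnp_prob n p B + gnp_prob n p C.
Proof.
move=> ABC; rewrite (gnp_probE _ B) (gnp_probE _ C) -big_split/=.
under [leRHS]eq_bigr do rewrite -mulrDr.
apply: (gnp_prob_markov p01 (f := fun E => (B E)%:R + (C E)%:R)) => [E|E /ABC].
  by rewrite addr_ge0.
by case: (B E); case: (C E) => //= _; rewrite ?addr0 ?add0r// lerDl.
Qed.

Lemma gnp_prob_localization_le (K : nat) : (K < n)%N ->
  gnp_prob n p (fun E => localization_number (adj E) <= K)%N <=
  (n ^ 2)%:R * (1 - p ^+ 2) ^+ (n - 2) +
  (n ^ K.+1)%:R * (expR 1 * n.+1%:R * expR 2^-1 *
    (p * expR (- (Num.sqrt ((p ^+ 2 + (1 - p) ^+ 2) ^+ K) / 4)) + (1 - p)) ^+ (n - K.+1)).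
Proof.
move=> Kn; have /andP[p0 p1] := p01.
pose bad1 (uv : 'I_n * 'I_n) E := [forall w, (w \notin [set uv.1; uv.2]) ==>
  ~~ [forall t in [set uv.1; uv.2], adj E w t == (t \in [set uv.1; uv.2])]].
pose bad2 (vW : 'I_n * {set 'I_n}) E := let: (v, W) := vW in
  [forall x, forall y, [&& adj E v x, adj E v y, x \notin v |: (W :\ v),
     y \notin v |: (W :\ v) & [forall w in W :\ v, adj E x w == adj E y w]] ==> (x == y)].
pose Bad1 E := [exists uv : 'I_n * 'I_n, (uv.1 != uv.2) && bad1 uv E].
pose Bad2 E := [exists vW : 'I_n * {set 'I_n}, (#|vW.2| == K) && bad2 vW E].
apply: le_trans (gnp_prob_or (B := Bad1) (C := Bad2) _) _.
  move=> E; apply: contraTT; rewrite negb_or -ltnNge => /andP[/existsPn good1 /existsPn good2].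
  apply: localization_number_adj_gt => [||u v uv|v W WK].
  - exact: leq_ltn_trans Kn.
  - exact: ltnW.
  - have := good1 (u, v); rewrite uv /= => /forallPn[w].
    rewrite negb_imply negbK => /andP[wuv /forall_inP adjw].
    apply/orP; right; apply/existsP; exists w.
    by rewrite (adj_sym E u) !(eqP (adjw _ _)) !inE ?eqxx ?orbT.
  - have := good2 (v, W); rewrite WK eqxx /= => /forallPn[x /forallPn[y]].
    rewrite negb_imply => /andP[/and5P[vx vy xW yW /forall_inP same] xy].
    have vWE : v |: W = v |: (W :\ v).
      by apply/setP => z; rewrite !inE; case: eqP.
    exists x, y; rewrite vWE xW yW; split=> // w wW.
    exact/eqP/same.
apply: lerD.
  apply: le_trans (gnp_prob_union p01 (Q := fun uv : 'I_n * 'I_n => uv.1 != uv.2)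
     (A_ := bad1) (b := (1 - p ^+ 2) ^+ (n - 2)) _ _) _.
  - by move=> E /existsP[uv /andP[? ?]]; exists uv.
  - move=> [u v] /= uv; rewrite gnp_prob_extension// cards2 uv.
    rewrite (eq_bigr (fun=> p)) => [|t ->//]; rewrite prodr_const cards2 uv.
    exact: lexx.
  - rewrite ler_wpM2r ?exprn_ge0 ?subr_ge0 ?exprn_ile1//.
    by rewrite ler_nat (leq_trans (max_card _))// card_prod card_ord expnS expn1.
set s := Num.sqrt _; set b := expR 1 * _ * _ * _.
have base t : 0 <= p * expR t + (1 - p).
  by rewrite addr_ge0 ?mulr_ge0 ?expR_ge0 ?subr_ge0.
have s0 : 0 <= s by exact: sqrtr_ge0.
have b0 : 0 <= b by rewrite !mulr_ge0 ?expR_ge0 ?exprn_ge0.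
have rho0 : 0 <= p ^+ 2 + (1 - p) ^+ 2 by rewrite addr_ge0 ?sqr_ge0.
have rho1 : p ^+ 2 + (1 - p) ^+ 2 <= 1 by nra.
apply: le_trans (gnp_prob_union p01 (Q := fun vW : 'I_n * {set 'I_n} => #|vW.2| == K)
     (A_ := bad2) (b := b) _ _) _.
- by move=> E /existsP[uv /andP[? ?]]; exists uv.
- move=> [v W] /= /eqP WK.
  have vW : v \notin W :\ v by rewrite !inE eqxx.
  apply: le_trans (gnp_prob_injective_nbr p01 vW) _ => /=.
  have WvK : (#|W :\ v| <= K)%N by rewrite -WK subset_leq_card// subD1set.
  rewrite ler_wpM2l ?mulr_ge0 ?expR_ge0//.
  apply: le_trans (_ : (p * expR (- (s / 4)) + (1 - p)) ^+ (n - #|W :\ v|.+1) <= _).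
    rewrite lerXn2r ?nnegrE ?base//.
    rewrite lerD2r ler_wpM2l// ler_expR lerN2 ler_pM2r// ler_sqrt ?exprn_ge0//.
    exact: ler_wiXn2l.
  rewrite ler_wiXn2l//; last by rewrite leq_sub2l// ltnS.
  rewrite -[leRHS](subrKC p) lerD2r -[leRHS]mulr1 ler_wpM2l// -expR0 ler_expR.
  by rewrite oppr_le0 divr_ge0.
- rewrite ler_wpM2r// ler_nat.
  rewrite (_ : #|_| = #|setX [set: 'I_n] [set W : {set 'I_n} | #|W| == K]|).
    by rewrite cardsX cardsT card_draws card_ord expnS leq_mul2l bin_le_expn orbT.
  by apply: eq_card => -[v W]; rewrite !inE.
Qed.

Lemma gnp_prob_unseparated (sigma theta : R) : 0 <= theta ->
  gnp_prob n p (fun E => [exists uv : 'I_n * 'I_n, (uv.1 != uv.2) &&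
    (#|[set w in ~: [set uv.1; uv.2] | adj E w uv.1 != adj E w uv.2]|%:R < sigma * n%:R)])
  <= (n ^ 2)%:R * (expR (theta * (sigma * n%:R)) *
       (1 - 2 * p * (1 - p) * (1 - expR (- theta))) ^+ (n - 2)).
Proof.
move=> th0; set b := expR _ * _.
pose A_ (uv : 'I_n * 'I_n) E :=
  #|[set w in ~: [set uv.1; uv.2] | adj E w uv.1 != adj E w uv.2]|%:R < sigma * n%:R.
have b0 : 0 <= b.
  have /andP[p0 p1] := p01; have e1 : expR (- theta) <= 1 by rewrite -expR0 ler_expR oppr_le0.
  have e0 := expR_ge0 (- theta).
  rewrite mulr_ge0 ?expR_ge0// exprn_ge0//.
  have : 2 * p * (1 - p) <= 1 by nra.
  have : 0 <= 2 * p * (1 - p) by nra.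
  by nra.
apply: le_trans (gnp_prob_union p01 (Q := fun uv : 'I_n * 'I_n => uv.1 != uv.2)
     (A_ := A_) (b := b) _ _) _.
- by move=> E /existsP[uv /andP[? ?]]; exists uv.
- move=> [u v] uv; rewrite /b -(subset_mean_separated _ _ uv) -subset_meanZ.
  apply: gnp_prob_markov => [//|E|E] /=; first by rewrite mulr_ge0 ?exprn_ge0 ?expR_ge0.
  rewrite /A_ /= => /ltW few; rewrite -expRM_natl -expRD -[leLHS]expR0 ler_expR.
  by rewrite mulrN subr_ge0 mulrC ler_wpM2l.
- rewrite ler_wpM2r// ler_nat (leq_trans (max_card _))//.
  by rewrite card_prod card_ord expnS expn1.
Qed.

Lemma expR1_le4 : expR 1 <= 4 :> R.
Proof.
have h : expR (2^-1) <= 2 :> R.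
  have := expR_ge1Dx (- 2^-1 : R); rewrite expRN => h.
  rewrite -[leLHS]invrK -[leRHS]invrK lef_pV2 ?posrE ?invr_gt0 ?expR_gt0//.
  by apply: le_trans h; lra.
have -> : (1 : R) = 2^-1 + 2^-1 by lra.
rewrite expRD; apply: le_trans (ler_pM _ _ h h) _; rewrite ?expR_ge0//; lra.
Qed.

Lemma gnp_prob_degree :
  gnp_prob n p (fun E => [exists v, 4 * (p * n%:R) < #|[set w in ~: [set v] | adj E v w]|%:R])
  <= n%:R * expR (- (p * n%:R)).
Proof.
have /andP[p0 p1] := p01.
pose A_ v E := 4 * (p * n%:R) < #|[set w in ~: [set v] | adj E v w]|%:R.
apply: le_trans (gnp_prob_union p01 (Q := predT)
     (A_ := A_) (b := expR (- (p * n%:R))) _ _) _.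
- by move=> E /existsP[v ?]; exists v.
- move=> v _.
  apply: le_trans (_ : expR (- (4 * (p * n%:R))) * (p * expR 1 + (1 - p)) ^+ (n - 1) <= _).
    have vv : v \notin ~: [set v] by rewrite !inE eqxx.
    rewrite -[X in (n - X)%N](cards1 v) -cardC_ord -(subset_mean_degree _ _ vv) -subset_meanZ.
    apply: gnp_prob_markov => [//|E|E] /=; first by rewrite mulr_ge0 ?exprn_ge0 ?expR_ge0.
    rewrite /A_ /= => /ltW many; rewrite -expRM_natl -expRD -[leLHS]expR0 ler_expR mulr1.
    by rewrite addrC subr_ge0.
  have e1 := expR1_le4.
  have h : p * expR 1 + (1 - p) <= expR (p * 3).
    by apply: le_trans (expR_ge1Dx _); nra.
  have h1 : 1 <= expR (p * 3) by rewrite -[leLHS]expR0 ler_expR mulr_ge0.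
  apply: le_trans (_ : expR (- (4 * (p * n%:R))) * expR (p * 3) ^+ n <= _).
    rewrite ler_wpM2l ?expR_ge0//; apply: le_trans (ler_weXn2l _ (leq_subr 1 n)) => //.
    by rewrite lerXn2r ?nnegrE ?expR_ge0// addr_ge0 ?subr_ge0 ?mulr_ge0 ?expR_ge0.
  rewrite -expRM_natl -expRD ler_expR.
  have : 0 <= p * n%:R by rewrite mulr_ge0.
  lra.
- by rewrite ler_wpM2r ?expR_ge0// ler_nat (leq_trans (max_card _))// card_ord.
Qed.

Lemma gnp_prob_no_extension (M : nat) (mu : R) : 0 <= mu -> mu <= p -> mu <= 1 - p ->
  gnp_prob n p (fun E => [exists T : {set 'I_n}, (#|T| == M) &&
     [exists T1 : {set 'I_n}, (T1 \in powerset T) &&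
       [forall w, (w \notin T) ==> ~~ [forall t in T, adj E w t == (t \in T1)]]]])
  <= (n ^ M)%:R * ((2 ^ M)%:R * (1 - mu ^+ M) ^+ (n - M)).
Proof.
move=> mu0 mup muq.
have mu1 : mu ^+ M <= 1 by rewrite exprn_ile1//; lra.
pose A1 (T T1 : {set 'I_n}) E :=
  [forall w, (w \notin T) ==> ~~ [forall t in T, adj E w t == (t \in T1)]].
pose A_ (T : {set 'I_n}) E := [exists T1 : {set 'I_n}, (T1 \in powerset T) && A1 T T1 E].
set b := _ ^+ (n - M); have b0 : 0 <= b by rewrite exprn_ge0// subr_ge0.
apply: le_trans (gnp_prob_union p01 (Q := fun T : {set 'I_n} => #|T| == M)
     (A_ := A_) (b := (2 ^ M)%:R * b) _ _) _.
- by move=> E /existsP[T /andP[? ?]]; exists T.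
- move=> T /eqP TM.
  apply: le_trans (gnp_prob_union p01 (Q := mem (powerset T))
     (A_ := A1 T) (b := b) _ _) _; last by rewrite card_powerset TM.
    by move=> E /existsP[T1 /andP[? ?]]; exists T1.
  move=> T1 _; rewrite gnp_prob_extension// TM lerXn2r ?nnegrE ?subr_ge0//.
    rewrite prodr_ile1// => t _; case: ifP => _; apply/andP; split; lra.
  rewrite lerD2l lerN2 -TM -prodr_const; apply: ler_prod => t _.
  by rewrite mu0; case: ifP.
- rewrite ler_wpM2r ?mulr_ge0// ler_nat -[X in (_ <= X ^ _)%N](card_ord n).
  apply: leq_trans (bin_le_expn _ _); rewrite -card_draws; apply: subset_leq_card.
  by apply/subsetP => T; rewrite inE.
Qed.

End UnionBounds.

Lemma double_le_of_sqr_lt (K n : nat) : (K * K < n -> 32 < n -> 2 * K.+1 <= n)%N.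
Proof. by have [K16|K16] := leqP K 15; [lia|nia]. Qed.

Lemma half_le_sub (K n : nat) : (2 * K <= n -> n <= (n - K) * 2)%N.
Proof. by lia. Qed.

Section RealFacts.
Variable R : realType.
Implicit Types (x p L : R) (n m : nat).

Lemma expn1B_le_expR x m : x <= 1 -> (1 - x) ^+ m <= expR (- (x * m%:R)).
Proof.
move=> x1; rewrite mulrC -mulrN expRM_natl lerXn2r ?nnegrE ?subr_ge0 ?expR_ge0//.
exact: expR_ge1Dx.
Qed.

Lemma expRN_le_sqr x : 0 <= x -> expR (- x) <= 1 - x + x ^+ 2.
Proof.
move=> x0; have h := expR_ge1Dx x.
rewrite expRN; apply: le_trans (_ : (1 + x)^-1 <= _).
  by rewrite lef_pV2 ?posrE ?expR_gt0//; lra.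
rewrite -[leLHS]mul1r ler_pdivrMr; last lra.
have -> : (1 - x + x ^+ 2) * (1 + x) = 1 + x ^+ 3 by ring.
by rewrite lerDl exprn_ge0.
Qed.

Lemma expR_lnV p : 0 < p -> expR (- ln (1 / p)) = p.
Proof.
by move=> p0; rewrite div1r lnV ?posrE// opprK lnK ?posrE.
Qed.

Lemma expR_ln_nat n : 0 < ln (n%:R : R) -> expR (ln n%:R) = n%:R :> R.
Proof.
move=> L0; rewrite lnK// posrE lt_def ler0n andbT; apply/eqP => n0.
by move: L0; rewrite n0 ln0 ?ltxx.
Qed.

Section Rho.
Variable p : R.
Hypothesis p01 : 0 < p < 1.
Let rho : R := p ^+ 2 + (1 - p) ^+ 2.

Lemma rho_gt0 : 0 < rho.
Proof. by case/andP: p01 => *; rewrite /rho addr_gt0// exprn_gt0// subr_gt0. Qed.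

Lemma ln_rho_ge : 2 * p * (1 - p) <= ln (1 / rho).
Proof.
have e : rho = 1 - 2 * p * (1 - p) by rewrite /rho; ring.
have := expR_ge1Dx (- (2 * p * (1 - p))); rewrite -e.
by rewrite -[X in X <= _](expR_lnV rho_gt0) ler_expR lerN2.
Qed.

Lemma half_le_rho : 2^-1 <= rho.
Proof. by rewrite /rho -subr_ge0; have := sqr_ge0 (p - 2^-1); nra. Qed.

Lemma ln_rho_le1 : ln (1 / rho) <= 1.
Proof.
rewrite -lerN2 -ler_expR expR_lnV ?rho_gt0//.
apply: le_trans half_le_rho; rewrite expRN lef_pV2 ?posrE ?expR_gt0//.
by have := expR_ge1Dx (1 : R).
Qed.

Lemma ln_rho_gt0 : 0 < ln (1 / rho).
Proof.
apply: lt_le_trans ln_rho_ge; case/andP: p01 => *.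
by rewrite !mulr_gt0// subr_gt0.
Qed.

End Rho.

Lemma lower_tail n p (L := ln n%:R : R) : 32 <= L -> 0 < p -> p <= 1 - 3 * ln L / L ->
  gnp_prob n p (fun E => (localization_number (adj E))%:R <
    (1 - 2 * (ln (1 / p) / L) - 4 * ln L / L) * (2 * L / ln (1 / (p ^+ 2 + (1 - p) ^+ 2))))
  <= 2 / n%:R.
Proof.
move=> L32 p0 pL.
have L0 : 0 < L by lra.
have nE : expR L = n%:R := expR_ln_nat L0.
have l1 : 1 <= ln L.
  rewrite -ler_expR lnK ?posrE//; apply: le_trans (expR1_le4 R) _; lra.
set a := ln (1 / p); set l := ln L in l1 pL *; set rho := p ^+ 2 + _; set H := ln (1 / rho).
have q3 : 3 / L <= 1 - p.
  have : 3 / L <= 3 * l / L by rewrite ler_wpM2r ?invr_ge0 ?(ltW L0)//; lra.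
  lra.
have q0 : 0 < 1 - p by apply: lt_le_trans q3; rewrite divr_gt0.
have p01 : 0 < p < 1 by rewrite p0 /=; lra.
have H0 : 0 < H := ln_rho_gt0 p01.
have Hge : 2 * p * (1 - p) <= H := ln_rho_ge p01.
set lb := _ * _.
have lbE : lb = 2 * (L - 2 * a - 4 * l) / H.
  by rewrite /lb; field; rewrite !gt_eqF.
have [lb0|lb0] := leP lb 0.
  apply: le_trans (_ : 0 <= _); last by rewrite divr_ge0.
  rewrite gnp_probE /subset_mean big1// => E _.
  by rewrite ltNge (le_trans lb0)// mulr0.
set K := Num.truncn lb.
have KH : K%:R * H <= 2 * (L - 2 * a - 4 * l).
  rewrite -ler_pdivlMr// -lbE.
  by have /andP[] := truncn_itv (ltW lb0).
have pE : expR (- a) = p by exact: expR_lnV.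
have a0 : 0 <= a by rewrite -oppr_le0 -ler_expR pE expR0; lra.
have La : 0 < L - 2 * a - 4 * l.
  by move: lb0; rewrite lbE pmulr_lgt0 ?invr_gt0// pmulr_rgt0.
have LE : expR l = L by rewrite lnK ?posrE.
have pn : L ^+ 4 < p ^+ 2 * n%:R.
  by rewrite -nE -pE -LE -!expRM_natl -expRD ltr_expR; lra.
have Kp : K%:R * p <= L ^+ 2.
  have h1 : K%:R * (2 * p * (1 - p)) <= 2 * L.
    apply: le_trans (_ : K%:R * H <= _); first by rewrite ler_wpM2l.
    by apply: le_trans KH _; lra.
  have h2 : K%:R * p * (3 / L) <= K%:R * p * (1 - p) by rewrite ler_wpM2l// mulr_ge0// ltW.
  have h3 : K%:R * p * (3 / L) <= L by nra.
  move: h3; rewrite mulrA ler_pdivrMr// expr2 => h3.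
  have : 0 <= K%:R * p by rewrite mulr_ge0// ltW.
  lra.
have p1 : p <= 1 by lra.
have Kn2 : (K * K < n)%N.
  rewrite -(ltr_nat R) natrM -(@ltr_pM2l _ (p ^+ 2)) ?exprn_gt0//.
  apply: le_lt_trans pn; rewrite (_ : _ * _ = (K%:R * p) ^+ 2); last by ring.
  by rewrite -[4%N]/(2 * 2)%N exprM lerXn2r// nnegrE mulr_ge0// ?exprn_ge0// ltW.
have n33 : (32 < n)%N.
  by rewrite -(ltr_nat R) -nE; have := expR_ge1Dx L; lra.
have K2n : (2 * K.+1 <= n)%N := double_le_of_sqr_lt Kn2 n33.
have Kn : (K < n)%N by apply: leq_trans K2n; rewrite leq_pmull.
apply: le_trans (_ : gnp_prob n p (fun E => localization_number (adj E) <= K)%N <= _).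
  apply: gnp_prob_mono => [|E]; first by apply/andP; split; lra.
  by move=> /ltW lelb; rewrite truncn_ge_nat// ltW.
apply: le_trans (gnp_prob_localization_le _ Kn) _; first by apply/andP; split; lra.
have L4 : 32 * (8 * L) <= L ^+ 4.
  have L2 : 32 * L <= L ^+ 2 by rewrite expr2 ler_pM2r.
  have L3 : 32 * L ^+ 2 <= L ^+ 3 by rewrite [leRHS]exprS ler_pM2r ?exprn_gt0.
  have L4 : 32 * L ^+ 3 <= L ^+ 4 by rewrite [leRHS]exprS ler_pM2r ?exprn_gt0.
  lra.
rewrite -[2 / _](_ : expR (- L) + expR (- L) = _); last by rewrite expRN nE; ring.
apply: lerD.
  apply: le_trans (_ : expR (2 * L) * expR (- (p ^+ 2 * (n - 2)%:R)) <= _).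
    rewrite expRM_natl nE natrX ler_wpM2l ?exprn_ge0//.
    by apply: expn1B_le_expR; rewrite exprn_ile1// ltW.
  rewrite -expRD ler_expR natrB; last exact: leq_trans n33.
  have p2 : p ^+ 2 <= 1 by rewrite exprn_ile1// ltW.
  by rewrite mulrBr; lra.
set s := Num.sqrt _; set s0 := expR (- (L - 2 * a - 4 * l)).
have s01 : s0 <= 1 by rewrite /s0 -[leRHS]expR0 ler_expR; lra.
have s00 : 0 < s0 by rewrite expR_gt0.
have ss0 : s0 <= s.
  rewrite -[leLHS]ger0_norm ?(ltW s00)// -sqrtr_sqr /s ler_sqrt; last first.
    by rewrite exprn_ge0// ltW// (rho_gt0 p01).
  rewrite -(expR_lnV (rho_gt0 p01)) -/rho -/H -!expRM_natl ler_expR; lra.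
have baseB : p * expR (- (s / 4)) + (1 - p) <= 1 - p * s0 / 8.
  have h : expR (- (s / 4)) <= 1 - s0 / 8.
    apply: le_trans (_ : expR (- (s0 / 4)) <= _); first by rewrite ler_expR; lra.
    apply: le_trans (expRN_le_sqr _) _; first by lra.
    have -> : 1 - s0 / 4 + (s0 / 4) ^+ 2 = 1 - s0 / 4 + s0 * s0 / 16 by field.
    have : s0 * s0 <= s0 * 1 by rewrite ler_pM2l.
    by lra.
  have := ler_wpM2l (ltW p0) h; rewrite mulrBr mulr1 mulrA; lra.
have base0 : 0 <= p * expR (- (s / 4)) + (1 - p).
  by rewrite addr_ge0 ?mulr_ge0 ?expR_ge0 ?(ltW p0) ?(ltW q0).
have ps1 : p * s0 / 8 <= 1.
  have : p * s0 <= 1 * 1 by apply: ler_pM => //; apply: ltW.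
  by lra.
set Z := L ^+ 4 / p.
have ZE : p * s0 * n%:R = Z.
  have -> : p * s0 * n%:R = expR a * expR l ^+ 4.
    by rewrite /s0 -nE -pE -!expRM_natl -!expRD; congr expR; ring.
  by rewrite LE /Z -pE -expRN opprK mulrC.
have powB : (p * expR (- (s / 4)) + (1 - p)) ^+ (n - K.+1) <= expR (- (Z / 16)).
  apply: le_trans (_ : (1 - p * s0 / 8) ^+ (n - K.+1) <= _).
    by rewrite lerXn2r// nnegrE ?(le_trans base0).
  apply: le_trans (expn1B_le_expR _ ps1) _; rewrite ler_expR lerN2 -ZE.
  have nK : n%:R / 2 <= (n - K.+1)%:R :> R.
    by rewrite ler_pdivrMr// -natrM ler_nat half_le_sub.
  have := ler_wpM2l (_ : 0 <= p * s0 / 8) nK.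
  by rewrite divr_ge0 ?mulr_ge0 ?(ltW p0) ?(ltW s00)// => /(_ isT); lra.
have ZK : K%:R * L <= Z / 32.
  have h : K%:R * L * p <= L ^+ 3.
    by rewrite mulrAC [leRHS]exprSr ler_wpM2r// ltW.
  rewrite /Z mulrAC ler_pdivlMr// (le_trans h)//.
  by rewrite ler_pdivlMr// [leRHS]exprSr ler_wpM2l ?exprn_ge0// ltW.
have Z4 : L ^+ 4 <= Z.
  by rewrite /Z ler_pdivlMr// -[leRHS]mulr1 ler_wpM2l// exprn_ge0// ltW.
have nB : n.+1%:R <= expR (2 * L) :> R.
  have -> : expR (2 * L) = n%:R * n%:R.
    by rewrite -nE -expRD; congr expR; ring.
  rewrite -natrM ler_nat (leq_trans (_ : _ <= n * 2)%N)//.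
    by rewrite muln2 -addnn -addn1 leq_add2l (leq_trans _ n33).
  by rewrite leq_mul2l (leq_trans _ n33) ?orbT.
have nK : (n ^ K.+1)%:R = expR (K.+1%:R * L) :> R.
  by rewrite natrX expRM_natl nE.
rewrite nK; apply: le_trans (_ : expR (K.+1%:R * L) *
  (expR 1 * expR (2 * L) * expR 2^-1 * expR (- (Z / 16))) <= _).
  rewrite ler_wpM2l ?expR_ge0//; apply: ler_pM => //.
  - by rewrite exprn_ge0.
  - by rewrite ler_wpM2r ?expR_ge0// ler_wpM2l ?expR_ge0.
rewrite -!expRD ler_expR -natr1 mulrDl mul1r.
move: (L) (Z) (L ^+ 4) (K%:R * L) L4 Z4 ZK L32; clear => L Z L4 KL h1 h2 h3 h4; lra.
Qed.
End RealFacts.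

Section UpperTail.
Variables (R : realType) (n : nat) (p : R).
Let L : R := ln n%:R.
Let a : R := ln (1 / p).
Let H : R := ln (1 / (p ^+ 2 + (1 - p) ^+ 2)).
Let sigma : R := 2 * p * (1 - p) * (1 - L^-1).
Hypotheses (L4 : 4 <= L) (p01 : 0 < p < 1).
Hypothesis pqn : 2 * L ^+ 2 * (3 * L + 1) <= p * (1 - p) * n%:R.

Let L0 : 0 < L. Proof. by move: L4; lra. Qed.
Let p0 : 0 < p. Proof. by case/andP: p01. Qed.
Let q0 : 0 < 1 - p. Proof. by case/andP: p01 => _ ?; rewrite subr_gt0. Qed.
Let p01w : 0 <= p <= 1. Proof. by case/andP: p01 => *; rewrite !ltW. Qed.
Let H0 : 0 < H. Proof. exact: ln_rho_gt0 p01. Qed.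
Let pqH : 2 * p * (1 - p) <= H. Proof. exact: ln_rho_ge p01. Qed.
Let pq_gt0 : 0 < p * (1 - p). Proof. by rewrite mulr_gt0. Qed.
Let pq_le : p * (1 - p) <= 1 / 4.
Proof. by have := sqr_ge0 (p - 2^-1); nra. Qed.

Let expRL : expR L = n%:R.
Proof. exact: expR_ln_nat L0. Qed.

Let n_gt2 : (2 <= n)%N.
Proof. by rewrite -(ler_nat R) -expRL; move: L4 (expR_ge1Dx L); lra. Qed.

Let L_le_pqn : 2 * L <= p * (1 - p) * n%:R.
Proof.
apply: le_trans pqn; have L2 : L <= L ^+ 2 by rewrite expr2 ler_peMr ?(ltW L0)//; move: L4; lra.
have : L ^+ 2 * 1 <= L ^+ 2 * (3 * L + 1) by rewrite ler_wpM2l ?sqr_ge0//; move: L0; lra.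
by rewrite mulr1 -mulrA; lra.
Qed.

Let p1 : p <= 1. Proof. by case/andP: p01w. Qed.

Let pn_ge : 2 * L <= p * n%:R.
Proof.
apply: le_trans L_le_pqn _; rewrite ler_wpM2r// -[leRHS]mulr1 ler_wpM2l ?(ltW p0)//.
by move: p0; lra.
Qed.

Let Linv : 0 < L^-1 <= 1 / 4.
Proof. by rewrite invr_gt0 L0 div1r lef_pV2 ?posrE. Qed.

Let sigma01 : 0 <= sigma <= 1.
Proof.
case/andP: Linv => ? ?; rewrite /sigma mulr_ge0 ?mulr_ge0 ?(ltW p0) ?(ltW q0)//=; last lra.
apply: le_trans (_ : 2 * p * (1 - p) * 1 <= _).
  by rewrite ler_wpM2l ?mulr_ge0 ?(ltW p0) ?(ltW q0)//; lra.
by move: pq_le; lra.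
Qed.

Lemma gnp_prob_unseparated_le :
  gnp_prob n p (fun E => [exists uv : 'I_n * 'I_n, (uv.1 != uv.2) &&
    (#|[set w in ~: [set uv.1; uv.2] | adj E w uv.1 != adj E w uv.2]|%:R < sigma * n%:R)])
  <= expR (- L).
Proof.
set theta := L^-1 / 2; have /andP[Li0 Li1] := Linv.
have th0 : 0 <= theta by rewrite /theta; lra.
apply: le_trans (gnp_prob_unseparated _ p01w _ th0) _.
set t := 1 - expR (- theta).
have t1 : t <= 1 by rewrite /t lerBlDr lerDl expR_ge0.
have t0 : theta - theta ^+ 2 <= t by rewrite /t; have := expRN_le_sqr th0; lra.
apply: le_trans (_ : expR (2 * L) * (expR (theta * (sigma * n%:R)) *
    expR (- (2 * p * (1 - p) * t * (n - 2)%:R))) <= _).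
  rewrite expRM_natl expRL natrX !ler_wpM2l ?expR_ge0 ?exprn_ge0//.
  apply: expn1B_le_expR; apply: le_trans (_ : 2 * p * (1 - p) * 1 <= _).
    by rewrite ler_wpM2l ?mulr_ge0 ?(ltW p0) ?(ltW q0).
  by move: pq_le; lra.
rewrite -!expRD ler_expR natrB// /sigma.
have pqN := pqn; have y0 := pq_gt0; have y4 := pq_le.
set y := p * (1 - p) in pqN y0 y4 *; set N := n%:R in pqN *.
have N2 : 0 <= N - 2 by rewrite subr_ge0 /N ler_nat.
have -> : 2 * p * (1 - p) * (1 - L^-1) = 2 * y * (1 - L^-1) by rewrite /y; ring.
have -> : 2 * p * (1 - p) * t * (N - 2) = 2 * y * (t * (N - 2)) by rewrite /y; ring.
have h1 : (theta - theta ^+ 2) * (N - 2) <= t * (N - 2) by rewrite ler_wpM2r.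
have h2 : 2 * y * ((theta - theta ^+ 2) * (N - 2)) <= 2 * y * (t * (N - 2)).
  by rewrite ler_wpM2l// mulr_ge0// (ltW y0).
have h3 : theta * (2 * y * (1 - L^-1) * N) - 2 * y * ((theta - theta ^+ 2) * (N - 2)) =
   - (y * N / L ^+ 2 / 2) + 4 * y * (theta - theta ^+ 2).
  by rewrite /theta; field; rewrite gt_eqF.
have h4 : 3 * L + 1 <= y * N / L ^+ 2 / 2.
  rewrite ler_pdivlMr// ler_pdivlMr ?exprn_gt0//.
  by apply: le_trans pqN; rewrite le_eqVlt; apply/orP; left; apply/eqP; ring.
have h5 : 4 * y * (theta - theta ^+ 2) <= 1 * 1.
  have th2 : 0 <= theta ^+ 2 by exact: sqr_ge0.
  have th3 : theta ^+ 2 <= theta.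
    by rewrite expr2 ler_piMr//; rewrite /theta; lra.
  have th1 : theta <= 1 by rewrite /theta; lra.
  apply: ler_pM.
  - by rewrite mulr_ge0 ?(ltW y0).
  - by rewrite subr_ge0.
  - by move: y4; rewrite ler_pdivlMr// mulrC.
  - by rewrite lerBlDr (le_trans th1)// lerDl.
move: h2 h3 h4 h5; rewrite mul1r.
move: (theta * _) (2 * y * (_ * _)) (2 * y * (_ * _)) (4 * y * _) (y * N / L ^+ 2 / 2).
by move=> v1 v2 v3 v4 v5 *; lra.
Qed.

Lemma gnp_prob_degree_le :
  gnp_prob n p (fun E => [exists v, 4 * (p * n%:R) < #|[set w in ~: [set v] | adj E v w]|%:R])
  <= expR (- L).
Proof.
apply: le_trans (gnp_prob_degree _ p01w) _; rewrite -[X in X * _]expRL -expRD ler_expR.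
by move: pn_ge; lra.
Qed.

Variable c : R.
Hypotheses (c01 : 0 < c < 1) (aL : a <= L / 2).
Let ub : R := (1 - c * (a / L)) * (2 * L / H).
Let k := Num.truncn ub.

Let pE : expR (- a) = p. Proof. exact: expR_lnV. Qed.
Let a0 : 0 <= a. Proof. by rewrite -oppr_le0 -ler_expR pE expR0. Qed.
Let ca : c * a <= a.
Proof. by case/andP: c01 => _ /ltW c1; rewrite -[leRHS]mul1r ler_wpM2r. Qed.
Let ca0 : 0 <= c * a. Proof. by case/andP: c01 => /ltW c1 _; rewrite mulr_ge0. Qed.
Let ubE : ub = 2 * (L - c * a) / H.
Proof. by rewrite /ub; field; rewrite !gt_eqF. Qed.
Let ub0 : 0 <= ub.
Proof. by rewrite ubE divr_ge0 ?(ltW H0)//; move: ca aL L0; lra. Qed.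
Let k_le_ub : k%:R <= ub. Proof. by have /andP[] := truncn_itv ub0. Qed.

Let kH_le : k%:R * H <= 2 * (L - c * a).
Proof. by rewrite -ler_pdivlMr// -ubE. Qed.
Let kH_gt : 2 * (L - c * a) <= k%:R * H + 1.
Proof.
have /andP[_ /ltW] := truncn_itv ub0; rewrite -/k {1}ubE ler_pdivrMr// => /le_trans; apply.
by rewrite -natr1 mulrDl mul1r lerD2l; exact: ln_rho_le1 p01.
Qed.
Let k_pq : k%:R * (p * (1 - p)) <= L.
Proof.
have h : k%:R * (2 * p * (1 - p)) <= k%:R * H by rewrite ler_wpM2l.
by move: kH_le ca0 h; lra.
Qed.
Let k_le_n : (k <= n)%N.
Proof.
rewrite -(ler_nat R) -(ler_pM2r pq_gt0); apply: le_trans k_pq _.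
by move: L_le_pqn L0; rewrite mulrC; lra.
Qed.

Let decay i : (i <= k)%N -> (1 - sigma) ^+ i <= expR (4 - i%:R * H).
Proof.
move=> ik; have /andP[Li0 Li1] := Linv.
have e : 1 - sigma <= expR (- H + 4 * (p * (1 - p)) / L).
  rewrite expRD (expR_lnV (rho_gt0 p01)).
  have := expR_ge1Dx (4 * (p * (1 - p)) / L); have := half_le_rho p.
  have rhoE : p ^+ 2 + (1 - p) ^+ 2 = 1 - 2 * p * (1 - p) by ring.
  rewrite rhoE => h1 h2.
  apply: le_trans (_ : (1 - 2 * p * (1 - p)) * (1 + 4 * (p * (1 - p)) / L) <= _).
    have x0 : 0 <= p * (1 - p) / L by rewrite divr_ge0 ?(ltW pq_gt0) ?(ltW L0).
    rewrite /sigma; have := ler_wpM2r (_ : 0 <= 4 * (p * (1 - p) / L)) h1.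
    by rewrite mulr_ge0// => /(_ isT); lra.
  by rewrite ler_wpM2l//; lra.
apply: le_trans (lerXn2r i _ _ e) _; rewrite ?nnegrE ?expR_ge0//.
  by case/andP: sigma01 => *; lra.
rewrite -expRM_natl ler_expR mulrDr mulrN addrC lerD2r.
have : i%:R * (p * (1 - p)) <= L.
  by apply: le_trans k_pq; rewrite ler_wpM2r ?(ltW pq_gt0)// ler_nat.
move=> h; rewrite mulrA ler_pdivrMr//; lra.
Qed.

Lemma upper_tail_of_cop_wins (B : pred {set {set 'I_n}}) :
  (forall E, ~~ B E -> (forall u v, u != v -> sigma * n%:R <=
      #|[set w in ~: [set u; v] | adj E w u != adj E w v]|%:R) ->
    cop_wins (adj E) k) ->
  gnp_prob n p B <= expR (- L) ->
  gnp_prob n p (fun E => ub < (localization_number (adj E))%:R) <= 2 / n%:R.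
Proof.
move=> win PB; rewrite -[2 / _](_ : expR (- L) + expR (- L) = _); last first.
  by rewrite expRN expRL; ring.
apply: le_trans (lerD gnp_prob_unseparated_le PB); apply: gnp_prob_or => // E.
apply: contraTT; rewrite negb_or -leNgt => /andP[/existsPn sep nB].
apply: le_trans k_le_ub; rewrite ler_nat; apply: localization_number_le.
by apply: win => // u v uv; have := sep (u, v); rewrite uv /= -leNgt.
Qed.

Lemma upper_tail_sparse : 52 <= (1 - c) * a ->
  gnp_prob n p (fun E => ub < (localization_number (adj E))%:R) <= 2 / n%:R.
Proof.
move=> big; apply: (upper_tail_of_cop_wins _ gnp_prob_degree_le) => E /existsPn deg sep.
apply: (cop_wins_sparse (R := R) _ sigma01 sep (d := 4 * (p * n%:R))) => //.
- exact: leq_trans n_gt2.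
- by rewrite !mulr_ge0// ltW.
- by move=> v; rewrite leNgt.
have pn1 : 1 <= p * n%:R by move: pn_ge L4; lra.
apply: le_lt_trans (_ : (5 * (p * n%:R)) ^+ 2 * expR (4 - k%:R * H) < _).
  apply: ler_pM; rewrite ?decay ?sqr_ge0//.
    by rewrite exprn_ge0// subr_ge0; case/andP: sigma01.
  by rewrite lerXn2r ?nnegrE//; lra.
have -> : (5 * (p * n%:R)) ^+ 2 * expR (4 - k%:R * H) =
    25 * expR (- (2 * a) + 2 * L + 4 - k%:R * H).
  have -> : 25 = 5 ^+ 2 :> R by rewrite -natrX.
  have pn2 : (p * n%:R) ^+ 2 = expR (2 * (- a + L)).
    by rewrite expRM_natl expRD pE expRL.
  by rewrite exprMn pn2 -mulrA -expRD; congr (_ * expR _); ring.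
apply: le_lt_trans (_ : 25 * expR (- (2 * ((1 - c) * a) - 5)) < _).
  by rewrite ler_pM2l// ler_expR; move: kH_gt; lra.
rewrite expRN; have := expR_ge1Dx (2 * ((1 - c) * a) - 5) => h.
by rewrite ltr_pdivrMr ?expR_gt0//; lra.
Qed.

Lemma upper_tail_dense (m : nat) : expR (5 + 2 * a) <= 2 ^+ m -> m%:R <= L ->
  (4 ^ m <= n)%N -> L^-1 <= p -> L^-1 <= 1 - p ->
  (n ^ 4 ^ m)%:R * ((2 ^ 4 ^ m)%:R * (1 - L^-1 ^+ (4 ^ m)) ^+ (n - 4 ^ m)) <= expR (- L) ->
  gnp_prob n p (fun E => ub < (localization_number (adj E))%:R) <= 2 / n%:R.
Proof.
move=> am mL mn Lp Lq err.
have Li0 : 0 <= L^-1 by rewrite invr_ge0 ltW.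
have ext_err := le_trans (gnp_prob_no_extension n p01w (4 ^ m) Li0 Lp Lq) err.
apply: (upper_tail_of_cop_wins _ ext_err).
move=> E /existsPn ext sep.
have mk : (m <= k)%N.
  rewrite truncn_ge_nat// ubE ler_pdivlMr//.
  apply: le_trans (_ : m%:R * 1 <= _); first by rewrite ler_wpM2l//; exact: ln_rho_le1 p01.
  by move: mL ca aL; lra.
rewrite -(subnK mk); apply: (cop_wins_dense (R := R) _ sigma01 sep) => //.
- exact: leq_trans n_gt2.
- by rewrite subnK.
- apply: le_trans (_ : n%:R ^+ 2 * expR (4 - (k - m)%:R * H) <= _).
    by rewrite ler_wpM2l ?sqr_ge0// decay// leq_subr.
  have eH : expR H <= 2.
    rewrite -[leLHS]invrK -[leRHS]invrK lef_pV2 ?posrE ?invr_gt0 ?expR_gt0//.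
    by rewrite -expRN (expR_lnV (rho_gt0 p01)) half_le_rho.
  apply: le_trans (_ : expR (5 + 2 * a) * expR H ^+ m <= _); last first.
    have -> : (4 : R) ^+ m = 2 ^+ m * 2 ^+ m by rewrite -exprMn -natrM.
    by apply: ler_pM; rewrite ?expR_ge0 ?exprn_ge0// lerXn2r ?nnegrE ?expR_ge0.
  rewrite -expRL -!expRM_natl -!expRD ler_expR natrB//.
  by move: kH_gt ca; lra.
- move=> T T1 TM; have := ext T; rewrite TM eqxx /= => /existsPn/(_ (T :&: T1)).
  rewrite powersetE subsetIl /= => /forallPn[w]; rewrite negb_imply negbK.
  move=> /andP[wT /forall_inP adjw]; exists w => // t tT.
  by rewrite (eqP (adjw t tT)) inE tT.
Qed.

End UpperTail.

Local Open Scope classical_set_scope.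
Local Open Scope ring_scope.

Section Asymptotics.
Variable R : realType.

Lemma near_ln_ge (B : R) : \forall n \near \oo, B <= ln (n%:R : R).
Proof.
near=> n; have h : expR B <= n%:R by near: n; exact: nbhs_infty_ger.
by rewrite -[leLHS]expRK ler_ln// posrE ?expR_gt0// (lt_le_trans _ h)// expR_gt0.
Unshelve. all: by end_near. Qed.

Lemma near_poly_ln_le (A : R) (k : nat) :
  \forall n \near \oo, A * ln n%:R ^+ k <= n%:R :> R.
Proof.
near=> n.
have : 1 <= ln (n%:R : R) by near: n; exact: near_ln_ge.
have : A * (k.+1)`!%:R <= ln n%:R by near: n; exact: near_ln_ge.
set L := ln _ => LA L1.
have L0 : 0 < L by lra.
have -> : n%:R = expR L by rewrite /L expR_ln_nat.
have f0 : 0 < (k.+1)`!%:R :> R by rewrite ltr0n fact_gt0.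
have := expR_ge1Dxn k (ltW L0) => h.
apply: le_trans (_ : L ^+ k.+1 / (k.+1)`!%:R <= _); last by lra.
by rewrite ler_pdivlMr// exprS mulrAC ler_wpM2r// exprn_ge0// ltW.
Unshelve. all: by end_near. Qed.

Lemma exists_expn2_ge (x : R) : exists m, x <= 2 ^+ m.
Proof.
exists (Num.truncn x).+1; apply: le_trans (ltW (truncnS_gt x)) _.
by rewrite -natrX ler_nat ltnW// ltn_expl.
Qed.

Lemma near_extension_error (M : nat) : \forall n \near \oo,
  let L : R := ln n%:R in
  (n ^ M)%:R * ((2 ^ M)%:R * (1 - L^-1 ^+ M) ^+ (n - M)) <= expR (- L).
Proof.
near=> n => /=.
have nM : (2 * M <= n)%N by near: n; exact: nbhs_infty_ge.
have : 1 <= ln (n%:R : R) by near: n; exact: near_ln_ge.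
have : (4 * M%:R + 2) * ln (n%:R : R) ^+ M.+1 <= n%:R.
  by near: n; exact: near_poly_ln_le.
set L := ln _ => poly L1.
have L0 : 0 < L by lra.
have nE : n%:R = expR L by rewrite /L expR_ln_nat.
have Li : L^-1 ^+ M <= 1 by rewrite exprn_ile1 ?invr_ge0 ?(ltW L0)// invf_le1.
have M2 : (2 ^ M)%:R <= expR M%:R :> R.
  rewrite natrX -[M%:R]mulr1 expRM_natl lerXn2r ?nnegrE ?expR_ge0//.
  by have := expR_ge1Dx (1 : R).
apply: le_trans (_ : expR (M%:R * L) * (expR M%:R * expR (- (L^-1 ^+ M * (n - M)%:R))) <= _).
  rewrite expRM_natl -nE natrX ler_wpM2l ?exprn_ge0//.
  by apply: ler_pM => //; [rewrite exprn_ge0// subr_ge0|exact: expn1B_le_expR].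
rewrite -!expRD ler_expR.
have half : n%:R / 2 <= (n - M)%:R :> R.
  by rewrite ler_pdivrMr// -natrM ler_nat half_le_sub.
have h : (2 * M%:R + 1) * L <= L^-1 ^+ M * (n - M)%:R.
  apply: le_trans (_ : L^-1 ^+ M * (n%:R / 2) <= _); last first.
    by rewrite ler_wpM2l// exprn_ge0// invr_ge0 ltW.
  rewrite exprVn [leRHS]mulrC ler_pdivlMr ?exprn_gt0// ler_pdivlMr//.
  apply: le_trans poly; rewrite exprS le_eqVlt; apply/orP; left; apply/eqP; ring.
have ML : M%:R <= M%:R * L by rewrite -[leLHS]mulr1 ler_wpM2l.
lra.
Unshelve. all: by end_near. Qed.

End Asymptotics.

Theorem theorem2 (R : realType) (omega p : nat -> R) (c : R)
    (L : nat -> R := fun n => ln n%:R)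
    (LL : nat -> R := fun n => ln (ln n%:R))
    (eta : nat -> R := fun n => ln (1 / p n) / L n)
    (q : nat -> R := fun n => 1 - p n)
    (rho : nat -> R := fun n => p n ^+ 2 + q n ^+ 2)
    (omega_littleo : omega =o_\oo L)
    (omega_infty : omega @ \oo --> +oo)
    (p_range : \forall n \near \oo,
       Num.sqrt ((2 * L n + omega n) / n%:R) <= p n <= 1 - 3 * LL n / L n)
    (c_gt0 : 0 < c)
    (c_lt : \forall n \near \oo,
       c < Num.min (2^-1 * ((L n - 3 * LL n) / ln (1 / p n) - 1)) 1) :
  (fun n => gnp_prob n (p n) (fun E =>
     (1 - 2 * eta n - 4 * LL n / L n) * (2 * L n / ln (1 / rho n))
       <= (localization_number (adj E))%:R
       <= (1 - c * eta n) * (2 * L n / ln (1 / rho n)))) @ \oo --> (1 : R).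
Proof.
have c1 : c < 1.
  have [N _ /(_ N (leqnn N))] := c_lt.
  by rewrite lt_min => /andP[].
have c01 : 0 < c < 1 by rewrite c_gt0.
pose a0 := 52 / (1 - c).
have [m am] := exists_expn2_ge (expR (5 + 2 * a0)).
apply/cvgrPdist_le => eps eps0; near=> n.
have L32 : 32 <= L n by near: n; exact: near_ln_ge.
have Lm : m%:R <= L n by near: n; exact: near_ln_ge.
have La0 : expR a0 <= L n by near: n; exact: near_ln_ge.
have n4m : (4 ^ m <= n)%N by near: n; exact: nbhs_infty_ge.
have ext : (n ^ 4 ^ m)%:R * ((2 ^ 4 ^ m)%:R * (1 - (L n)^-1 ^+ (4 ^ m)) ^+ (n - 4 ^ m))
    <= expR (- L n) by near: n; exact: near_extension_error.
have poly : 64 * L n ^+ 8 <= n%:R by near: n; exact: near_poly_ln_le.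
have epsn : 4 / eps <= n%:R by near: n; exact: nbhs_infty_ger.
have omega1 : 1 <= omega n by near: n; move/cvgryPge : omega_infty; apply.
have /andP[p_ge p_le] : Num.sqrt ((2 * L n + omega n) / n%:R) <= p n <= 1 - 3 * LL n / L n.
  by near: n.
have L0 : 0 < L n by lra.
have nE : n%:R = expR (L n) by rewrite /L expR_ln_nat.
have n0 : 0 < n%:R :> R by rewrite nE expR_gt0.
have p2n : 1 <= p n ^+ 2 * n%:R.
  rewrite -ler_pdivrMr//; apply: le_trans (lerXn2r 2 _ _ p_ge); rewrite ?nnegrE ?sqrtr_ge0//.
    by rewrite sqr_sqrtr ?ler_pM2r ?invr_gt0 ?divr_ge0//; lra.
  exact: le_trans (sqrtr_ge0 _) p_ge.
have p0 : 0 < p n.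
  rewrite lt_neqAle (le_trans (sqrtr_ge0 _) p_ge) andbT; apply/eqP => e.
  by move: p2n; rewrite -e expr0n mul0r ler10.
have l1 : 1 <= LL n.
  rewrite -ler_expR /LL -/(L n) lnK ?posrE//; apply: le_trans (expR1_le4 R) _; lra.
have q_ge : 3 / L n <= 1 - p n.
  have : 3 / L n <= 3 * LL n / L n by rewrite ler_wpM2r ?invr_ge0 ?(ltW L0)//; lra.
  lra.
have Linv0 : 0 < (L n)^-1 by rewrite invr_gt0.
have p01 : 0 < p n < 1 by rewrite p0 /=; lra.
have pE : expR (- ln (1 / p n)) = p n by exact: expR_lnV.
have aL : ln (1 / p n) <= L n / 2.
  move: p2n pE; set a := ln _ => + e.
  by rewrite -e nE -expRM_natl -expRD -[leLHS]expR0 ler_expR; lra.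
have pn_ge : 8 * L n ^+ 4 <= p n * n%:R.
  rewrite -(@ler_pXn2r _ 2)// ?nnegrE ?mulr_ge0 ?exprn_ge0 ?(ltW p0) ?(ltW L0)//.
  rewrite exprMn -exprM -natrX [leRHS]exprMn [n%:R ^+ 2]expr2 mulrA.
  by apply: le_trans poly _; rewrite ler_peMl// ltW.
have pqn : 2 * L n ^+ 2 * (3 * L n + 1) <= p n * (1 - p n) * n%:R.
  apply: le_trans (_ : 8 * L n ^+ 3 <= _).
    have : L n ^+ 2 * 1 <= L n ^+ 2 * L n by rewrite ler_wpM2l ?sqr_ge0//; lra.
    by rewrite mulr1 -exprSr; lra.
  rewrite mulrAC; apply: le_trans (_ : p n * n%:R * (3 / L n) <= _).
    rewrite [leRHS]mulrA ler_pdivlMr// -[leLHS]mulrA -exprSr.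
    by apply: le_trans pn_ge _; rewrite ler_peMr ?mulr_ge0 ?(ltW p0)//; lra.
  by rewrite ler_wpM2l// mulr_ge0// ltW.
have low := lower_tail L32 p0 p_le.
have up : gnp_prob n (p n) (fun E => (1 - c * eta n) * (2 * L n / ln (1 / rho n)) <
    (localization_number (adj E))%:R) <= 2 / n%:R.
  have L4 : 4 <= L n by lra.
  have [big|small] := leP 52 ((1 - c) * ln (1 / p n)).
    exact: upper_tail_sparse.
  have aa0 : ln (1 / p n) <= a0.
    by rewrite /a0 ler_pdivlMr ?subr_gt0// mulrC ltW.
  apply: (upper_tail_dense L4 p01 pqn c01 aL _ Lm n4m _ _ ext).
  - by apply: le_trans am; rewrite ler_expR; lra.
  - rewrite -pE expRN lef_pV2 ?posrE ?expR_gt0//.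
    by apply: le_trans La0; rewrite ler_expR.
  - by apply: le_trans q_ge; lra.
have p01w : 0 <= p n <= 1 by case/andP: p01 => *; rewrite !ltW.
rewrite [X in 1 - X]gnp_probC opprB addrCA subrr addr0 ger0_norm ?gnp_prob_ge0//.
apply: le_trans (gnp_prob_or p01w _) (le_trans (lerD low up) _).
  by move=> E /=; rewrite negb_and -!ltNge.
rewrite -mulrDl -natrD ler_pdivrMr// mulrC -ler_pdivrMr//.
Unshelve. all: by end_near. Qed.
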